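(* Let $g:C\to D$ be a left codepth two homomorphism of coalgebras. Let $E=\operatorname{End}({}^DC^D)$ be the algebra (under composition) of $D$-$D$-bicomodule endomorphisms of $C$, and let $R=C^{*\,D^*}=V_{C^*}(D^* )$ be the centralizer subalgebra of $C^*$ induced by the dual algebra homomorphism $g^*:D^*\to C^*$. Then $E$ is a right bialgebroid over $R$. Moreover, the left $R$-module $E$ is finitely generated projective. The structure of the $R$-bialgebroid $E$ is given, for $r,r'\in R$, $c\in C$, $\alpha\in E$, by $$s(r)(c)=c_{(1)}r(c_{(2)}),\qquad t(r)(c)=r(c_{(1)})c_{(2)},\qquad (r\cdot\alpha\cdot r')(c)=r(c_{(1)})\,\alpha(c_{(2)})\,r'(c_{(3)}),$$ $$\Delta_E(\alpha)=\sum_{i=1}^N (C\otimes\eta_i)\circ\big((\underline{\Delta}\circ\alpha)\otimes C\big)\circ\underline{\Delta}\;\otimes_R\;\alpha_i,\qquad \varepsilon_E(\alpha)=\varepsilon\circ\alpha,$$ where $\alpha_i\in E$ and $\eta_i\in(C\,\Box_D\,C)^{*\,D^*}$ ($i=1,\dots,N$) are left codepth two quasibases, i.e. satisfy for all $c\otimes c'\in C\,\Box_D\,C$ $$c\otimes c'=\sum_{i=1}^N\eta_i(c\otimes c'_{(1)})\,\alpha_i(c'_{(2)})\otimes c'_{(3)}.$$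
   Context: Coalgebras are over a field $K$ (alternatively, over a commutative ring $K$, flat over $K$ and with $K$-duals that separate points). Unadorned tensors are over $K$; Sweedler notation $\Delta(c)=c_{(1)}\otimes c_{(2)}$ is used, $\Delta$ and $\varepsilon$ are the comultiplication and counit of $C$, an object's name may denote its identity map, and sums in $c\otimes c'$ are suppressed. A coalgebra homomorphism $g:C\to D$ makes any $C$-comodule a $D$-comodule; in particular $C$ is a $D$-$D$-bicomodule with coactions $c\mapsto g(c_{(1)})\otimes c_{(2)}$ and $c\mapsto c_{(1)}\otimes g(c_{(2)})$. The cotensor product is $C\,\Box_D\,C=\{c\otimes c'\in C\otimes C: c_{(1)}\otimes g(c_{(2)})\otimes c'=c\otimes g(c'_{(1)})\otimes c'_{(2)}\}$, a $C$-$C$-bicomodule via $\Delta\otimes C$ and $C\otimes\Delta$; $\underline{\Delta}:C\to C\,\Box_D\,C$ is $\Delta$ with restricted codomain. $g$ is left codepth two if $C\,\Box_D\,C$ is isomorphic, as a $D$-$C$-bicomodule, to a direct summand of $C^N$ for some positive integer $N$. (Left codepth two quasibases then exist.) $C^*$, $D^*$ are the dual algebras with convolution product and unit the counit; $g^*(d^* )=d^*\circ g$. $R=\{c^*\in C^*: c^*g^*(d^* )=g^*(d^* )c^*\ \forall d^*\in D^*\}$. $(C\,\Box_D\,C)^{*\,D^*}$ is the set of $\eta\in(C\,\Box_D\,C)^*=\operatorname{Hom}_K(C\,\Box_D\,C,K)$ with $d^*(g(c_{(1)}))\,\eta(c_{(2)}\otimes c')=\eta(c\otimes c'_{(1)})\,d^*(g(c'_{(2)}))$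 for all $d^*\in D^*$, $c\otimes c'\in C\,\Box_D\,C$. The first tensorand in $\Delta_E(\alpha)$ is the map $c\mapsto \alpha(c_{(1)})_{(1)}\,\eta_i(\alpha(c_{(1)})_{(2)}\otimes c_{(2)})$. Right bialgebroid: given $K$-algebras $R$, $E$, a right bialgebroid structure on $E$ over $R$ consists of an algebra homomorphism $s:R\to E$ (source) and an algebra anti-homomorphism $t:R\to E$ (target) with $s(r)t(r')=t(r')s(r)$ for all $r,r'$, together with maps $\Delta_E:E\to E\otimes_RE$ and $\varepsilon_E:E\to R$, where $E$ has the $R$-$R$-bimodule structure $r\cdot e\cdot r'=e\,s(r')\,t(r)$, such that: (1) $(E,R,\Delta_E,\varepsilon_E)$ is an $R$-coring: $\Delta_E,\varepsilon_E$ are $R$-$R$-bilinear, $\Delta_E$ is coassociative and $\varepsilon_E$ is a two-sided counit; (2) $\Delta_E(1_E)=1_E\otimes_R1_E$ and $\varepsilon_E(1_E)=1_R$; (3) $\Delta_E$ takes values in $E\times_RE=\{\sum_ix_i\otimes_Ry_i\in E\otimes_R E:\sum_is(r)x_i\otimes_Ry_i=\sum_ix_i\otimes_Rt(r)y_i\ \forall r\in R\}$, on which tensorwise multiplication is well defined; (4) $\Delta_E(ee')=\Delta_E(e)\Delta_E(e')$ for all $e,e'\in E$; (5) $\varepsilon_E(ee')=\varepsilon_E(s(\varepsilon_E(e))e')=\varepsilon_E(t(\varepsilon_E(e))e')$ for all $e,e'\in E$. *)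

(* Defs.v *)
From HB Require Import structures.
From mathcomp Require Import all_boot all_order all_algebra generic_quotient.
From mathcomp Require Import boolp classical_sets functions.

Set Implicit Arguments.
Unset Strict Implicit.
Unset Printing Implicit Defensive.

Import GRing.Theory.
Local Open Scope ring_scope.
Local Open Scope quotient_scope.

Section Tensor.
Context (A : Type) (M N : zmodType) (ra : M -> A -> M) (la : A -> N -> N).

(* [tensor ra la] is the tensor product of a right A-module M (with action ra)
   and a left A-module N (with action la): finite formal sums of pairs, modulo
   the congruence generated by biadditivity and (m.a, n) ~ (m, a.n). *)
Inductive tens_rel : seq (M * N) -> seq (M * N) -> Prop :=
| tens_refl s : tens_rel s s
| tens_sym s s' : tens_rel s s' -> tens_rel s' s
| tens_trans s s' s'' : tens_rel s s' -> tens_rel s' s'' -> tens_rel s s''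
| tens_cat s1 s1' s2 s2' :
    tens_rel s1 s1' -> tens_rel s2 s2' -> tens_rel (s1 ++ s2) (s1' ++ s2')
| tens_catC s1 s2 : tens_rel (s1 ++ s2) (s2 ++ s1)
| tens_0 n : tens_rel [:: (0, n)] [::]
| tens_Dl m m' n : tens_rel [:: (m + m', n)] [:: (m, n); (m', n)]
| tens_Dr m n n' : tens_rel [:: (m, n + n')] [:: (m, n); (m, n')]
| tens_bal m a n : tens_rel [:: (ra m a, n)] [:: (m, la a n)].

Definition tens_relb (s s' : seq (M * N)) : bool := `[< tens_rel s s' >].

Fact tens_relb_refl : reflexive tens_relb.
Proof. by move=> s; apply/asboolP; apply: tens_refl. Qed.
Fact tens_relb_sym : symmetric tens_relb.
Proof. by move=> s s'; apply/asboolP/asboolP => /tens_sym. Qed.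
Fact tens_relb_trans : transitive tens_relb.
Proof.
by move=> s s' s'' /asboolP h /asboolP h'; apply/asboolP; apply: tens_trans h'.
Qed.

Canonical tens_equiv :=
  EquivRel tens_relb tens_relb_refl tens_relb_sym tens_relb_trans.

Definition tensor : Type := {eq_quot tens_equiv}.
HB.instance Definition _ := Choice.on tensor.
HB.instance Definition _ : EqQuotient _ tens_equiv tensor :=
  EqQuotient.on tensor.

Definition tpure (m : M) (n : N) : tensor := \pi_tensor [:: (m, n)].

(* The value at z = sum of the m_i (x) n_i of the map induced by a balanced b.
   It is computed on the canonical representative of z, so that it makes sense
   for any b; for a balanced b it does not depend on the representative
   ([tsum_pi] below). *)
Definition tsum (P : zmodType) (b : M -> N -> P) (z : tensor) : P :=
  \sum_(p <- repr z) b p.1 p.2.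

Definition balanced (P : zmodType) (b : M -> N -> P) :=
  [/\ forall m m' n, b (m + m') n = b m n + b m' n,
      forall m n n', b m (n + n') = b m n + b m n' &
      forall m a n, b (ra m a) n = b m (la a n)].

Lemma tens_rel_pi s s' : tens_rel s s' <-> \pi_tensor s = \pi_tensor s'.
Proof. by split=> [h|/eqmodP/asboolP//]; apply/eqmodP/asboolP. Qed.

Lemma tens_rel_repr s : tens_rel (repr (\pi_tensor s)) s.
Proof. by apply/tens_rel_pi; apply: reprK. Qed.

Definition tens_zero : tensor := \pi_tensor [::].
Definition tens_add (x y : tensor) : tensor := \pi_tensor (repr x ++ repr y).
Definition tens_opp (x : tensor) : tensor :=
  \pi_tensor [seq (- p.1, p.2) | p <- repr x].

Lemma tensW (Q : tensor -> Prop) : (forall s, Q (\pi_tensor s)) -> forall x, Q x.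
Proof. by move=> h x; rewrite -[x]reprK; apply: h. Qed.

Lemma tens_addE s s' :
  tens_add (\pi_tensor s) (\pi_tensor s') = \pi_tensor (s ++ s').
Proof. by apply/tens_rel_pi; apply: tens_cat; apply: tens_rel_repr. Qed.

Fact tens_addA : associative tens_add.
Proof.
elim/tensW=> s1; elim/tensW=> s2; elim/tensW=> s3.
by rewrite (tens_addE s2) (tens_addE s1) (tens_addE s1) (tens_addE (s1 ++ s2)) catA.
Qed.
Fact tens_addC : commutative tens_add.
Proof. by move=> x y; rewrite /tens_add; apply/tens_rel_pi; apply: tens_catC. Qed.
Fact tens_add0 : left_id tens_zero tens_add.
Proof. by elim/tensW=> s; rewrite (tens_addE [::]). Qed.
Fact tens_addN : left_inverse tens_zero tens_opp tens_add.
Proof.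
move=> x; rewrite -[X in tens_add _ X]reprK tens_addE; apply/tens_rel_pi.
elim: (repr x) => [|[m n] s IH] /=; first exact: tens_refl.
rewrite -cat1s -[(m, n) :: s]cat1s catA.
apply: (tens_trans (s' := ([:: (- m, n)] ++ [:: (m, n)]) ++
                          ([seq (- p.1, p.2) | p <- s] ++ s))).
  rewrite -!catA; apply: tens_cat; first exact: tens_refl.
  by rewrite !catA; apply: tens_cat (tens_refl _); apply: tens_catC.
rewrite -[[::]]cats0; apply: tens_cat IH.
apply: (tens_trans (s' := [:: (- m + m, n)])).
  by apply: tens_sym; apply: tens_Dl.
by rewrite addNr; apply: tens_0.
Qed.

HB.instance Definition _ :=
  GRing.isZmodule.Build tensor tens_addA tens_addC tens_add0 tens_addN.

Lemma pi_cat s s' : \pi_tensor (s ++ s') = \pi_tensor s + \pi_tensor s' :> tensor.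
Proof. by rewrite -tens_addE. Qed.

Lemma tpureDl m m' n : tpure (m + m') n = tpure m n + tpure m' n.
Proof. by rewrite -pi_cat; apply/tens_rel_pi; apply: tens_Dl. Qed.
Lemma tpureDr m n n' : tpure m (n + n') = tpure m n + tpure m n'.
Proof. by rewrite -pi_cat; apply/tens_rel_pi; apply: tens_Dr. Qed.
Lemma tpure_bal m a n : tpure (ra m a) n = tpure m (la a n).
Proof. by apply/tens_rel_pi; apply: tens_bal. Qed.

Lemma balanced_tpure : balanced tpure.
Proof.
by split=> *; [apply: tpureDl | apply: tpureDr | apply: tpure_bal].
Qed.

Lemma tensE (z : tensor) : z = \sum_(p <- repr z) tpure p.1 p.2.
Proof.
rewrite -[LHS]reprK; elim: (repr z) => [|[m n] s IH]; first by rewrite big_nil.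
by rewrite big_cons -cat1s pi_cat IH.
Qed.

Lemma tensor_ind (Q : tensor -> Prop) :
  Q 0 -> (forall m n z, Q z -> Q (tpure m n + z)) -> forall z, Q z.
Proof.
move=> Q0 QS z; rewrite [z]tensE; elim: (repr z) => [|p s IH].
  by rewrite big_nil.
by rewrite big_cons; apply: QS.
Qed.

Section Tsum.
Context (P : zmodType) (b : M -> N -> P) (hb : balanced b).

Lemma tsum_rel s s' : tens_rel s s' ->
  \sum_(p <- s) b p.1 p.2 = \sum_(p <- s') b p.1 p.2.
Proof.
have [bDl bDr bB] := hb.
elim=> {s s'} //=.
- by move=> s s' s'' _ -> _ ->.
- by move=> s1 s1' s2 s2' _ e1 _ e2; rewrite !big_cat /= e1 e2.
- by move=> s1 s2; rewrite !big_cat /= addrC.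
- move=> n; rewrite big_seq1 big_nil /=.
  by apply: (addrI (b 0 n)); rewrite -bDl !addr0.
- by move=> m m' n; rewrite !big_cons !big_nil !addr0 bDl.
- by move=> m n n'; rewrite !big_cons !big_nil !addr0 bDr.
- by move=> m a n; rewrite !big_seq1 bB.
Qed.

Lemma tsum_pi s : tsum b (\pi_tensor s) = \sum_(p <- s) b p.1 p.2.
Proof. by apply: tsum_rel; apply: tens_rel_repr. Qed.

Lemma tsum_pure m n : tsum b (tpure m n) = b m n.
Proof. by rewrite tsum_pi big_seq1. Qed.

Lemma tsumD : {morph tsum b : x y / x + y}.
Proof.
by elim/tensW=> s1; elim/tensW=> s2; rewrite -pi_cat !tsum_pi big_cat.
Qed.

Lemma tsum0 : tsum b 0 = 0.
Proof. by apply: (addrI (tsum b 0)); rewrite -tsumD !addr0. Qed.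
End Tsum.

Lemma eq_tsum (P : zmodType) (b b' : M -> N -> P) z :
  (forall m n, b m n = b' m n) -> tsum b z = tsum b' z.
Proof. by move=> e; apply: eq_bigr => p _; apply: e. Qed.

Lemma raddf_tsum (P Q : zmodType) (f : {additive P -> Q}) (b : M -> N -> P) z :
  f (tsum b z) = tsum (fun m n => f (b m n)) z.
Proof. by rewrite raddf_sum. Qed.

Lemma tsumDf (P : zmodType) (b b' : M -> N -> P) z :
  tsum (fun m n => b m n + b' m n) z = tsum b z + tsum b' z.
Proof. by rewrite /tsum big_split. Qed.
End Tensor.

Notation "\tsum_ ( x , y <- z ) E" := (tsum (fun x y => E) z)
  (at level 41, E at level 41, x, y at level 50,
   format "\tsum_ ( x ,  y  <-  z )  E") : ring_scope.

Section TensorK.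
Context (K : comPzRingType).

Lemma linear_eqs (U V : lmodType K) (f : U -> V) : linear f ->
  (forall u u', f (u + u') = f u + f u') * (forall a u, f (a *: u) = a *: f u).
Proof.
move=> lf; have f0 : f 0 = 0.
  by apply: (addrI (f 0)); rewrite -{1}[f 0]scale1r -lf scaler0 !addr0.
by split=> [u u'|a u]; [rewrite -[u]scale1r lf !scale1r | rewrite -[a *: u]addr0 lf f0 addr0].
Qed.

Lemma linear_comp (U V W : lmodType K) (f : V -> W) (h : U -> V) :
  linear f -> linear h -> linear (fun x => f (h x)).
Proof. by move=> lf lh a x y; rewrite lh lf. Qed.

Definition tensK (U V : lmodType K) : Type :=
  tensor (fun (u : U) (a : K) => a *: u) (fun (a : K) (v : V) => a *: v).
HB.instance Definition _ U V := GRing.Zmodule.on (tensK U V).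

Definition tpureK (U V : lmodType K) (u : U) (v : V) : tensK U V :=
  tpure (fun u a => a *: u) (fun a v => a *: v) u v.

Section Scale.
Context (U V : lmodType K).

Definition tens_scale (a : K) (z : tensK U V) : tensK U V :=
  \tsum_(u, v <- z) tpureK (a *: u) v.

Lemma balancedK (P : lmodType K) (b : U -> V -> P) :
  (forall v, linear (b^~ v)) -> (forall u, linear (b u)) ->
  balanced (fun (u : U) (a : K) => a *: u) (fun (a : K) (v : V) => a *: v) b.
Proof.
move=> bl br.
split=> [u u' v|u v v'|u a v].
- exact: (linear_eqs (bl v)).1.
- exact: (linear_eqs (br u)).1.
- by rewrite (linear_eqs (bl v)).2 (linear_eqs (br u)).2.
Qed.

Lemma tens_scale_bal a : balanced (fun (u : U) (a : K) => a *: u)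
  (fun (a : K) (v : V) => a *: v) (fun u v => tpureK (a *: u) v).
Proof.
split=> [u u' v|u v v'|u c v]; rewrite /tpureK.
- by rewrite scalerDr tpureDl.
- by rewrite tpureDr.
- by rewrite -tpure_bal !scalerA mulrC.
Qed.

Lemma tens_scale_pure a u v : tens_scale a (tpureK u v) = tpureK (a *: u) v.
Proof. exact: tsum_pure (tens_scale_bal a) u v. Qed.

Lemma tens_scaleDr : right_distributive tens_scale +%R.
Proof. by move=> a x y; apply: tsumD; apply: tens_scale_bal. Qed.

Lemma tens_scale_0 a : tens_scale a 0 = 0.
Proof. exact: tsum0 (tens_scale_bal a). Qed.

Lemma tens_scaleA a b z : tens_scale a (tens_scale b z) = tens_scale (a * b) z.
Proof.
elim/tensor_ind: z => [|m n z IH]; first by rewrite !tens_scale_0.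
by rewrite !tens_scaleDr IH !tens_scale_pure scalerA.
Qed.
Lemma tens_scale1 : left_id 1 tens_scale.
Proof.
elim/tensor_ind => [|m n z IH]; first by rewrite !tens_scale_0.
by rewrite !tens_scaleDr IH !tens_scale_pure scale1r.
Qed.
Lemma tens_scaleDl z : {morph tens_scale^~ z : a b / a + b}.
Proof.
move=> a b; elim/tensor_ind: z => [|m n z IH].
  by rewrite !tens_scale_0 addr0.
rewrite !tens_scaleDr IH !tens_scale_pure scalerDl /tpureK tpureDl.
by rewrite addrACA.
Qed.

HB.instance Definition _ := GRing.Zmodule_isLmodule.Build K (tensK U V)
  tens_scaleA tens_scale1 tens_scaleDr tens_scaleDl.

Lemma tpureK_linl v : linear (fun u => tpureK u v).
Proof.
move=> a u u'; rewrite /tpureK tpureDl; congr (_ + _).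
exact: esym (tens_scale_pure a u v).
Qed.
Lemma tpureK_linr u : linear (fun v => tpureK u v).
Proof.
move=> a v v'; rewrite /tpureK tpureDr; congr (_ + _).
by rewrite -tpure_bal; exact: esym (tens_scale_pure a u v).
Qed.

Lemma tsumK_linear (P : lmodType K) (b : U -> V -> P) :
  (forall v, linear (b^~ v)) -> (forall u, linear (b u)) ->
  linear (fun z : tensK U V => tsum b z).
Proof.
move=> bl br; have hb := balancedK bl br => a x y.
rewrite tsumD //; congr (_ + _).
elim/tensor_ind: x => [|u v z IH]; first by rewrite scaler0 tsum0 // scaler0.
rewrite scalerDr !tsumD // IH scalerDr; congr (_ + _).
rewrite -[tpure _ _ u v]/(tpureK u v).
rewrite [X in tsum _ X](tens_scale_pure a u v) !(tsum_pure hb).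
exact: (linear_eqs (bl v)).2.
Qed.
End Scale.
End TensorK.

Notation "U \ox V" := (tensK U V) (at level 40, left associativity) : type_scope.
Notation "u \ot v" := (tpureK u v) (at level 40, left associativity) : ring_scope.

Section TensorMaps.
Context (K : comPzRingType).

Definition tmap (U U' V V' : lmodType K) (f : U -> U') (h : V -> V')
    (z : U \ox V) : U' \ox V' :=
  \tsum_(u, v <- z) f u \ot h v.

Definition tassoc (U V W : lmodType K) (z : (U \ox V) \ox W) : U \ox (V \ox W) :=
  \tsum_(x, w <- z) \tsum_(u, v <- x) u \ot (v \ot w).

Definition tassocV (U V W : lmodType K) (z : U \ox (V \ox W)) : (U \ox V) \ox W :=
  \tsum_(u, x <- z) \tsum_(v, w <- x) (u \ot v) \ot w.

Lemma tmap_linear (U U' V V' : lmodType K) (f : U -> U') (h : V -> V') :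
  linear f -> linear h -> linear (tmap f h).
Proof.
move=> lf lh; apply: tsumK_linear => [v|u] a x y.
  by rewrite lf; apply: tpureK_linl.
by rewrite lh; apply: tpureK_linr.
Qed.

Lemma linear_tsum (U V P Q : lmodType K) (f : P -> Q) (b : U -> V -> P)
    (z : U \ox V) : linear f ->
  f (\tsum_(u, v <- z) b u v) = \tsum_(u, v <- z) f (b u v).
Proof.
move=> lf; pose F : {linear P -> Q} := HB.pack f (GRing.isLinear.Build _ _ _ _ f lf).
exact: (raddf_tsum F).
Qed.

Lemma tsumK_pure (U V P : lmodType K) (b : U -> V -> P) u v :
  (forall v, linear (b^~ v)) -> (forall u, linear (b u)) ->
  \tsum_(x, y <- u \ot v) b x y = b u v.
Proof. by move=> bl br; apply: tsum_pure; apply: balancedK. Qed.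

Lemma tsum_lin_param (U V W P : lmodType K) (b : W -> U -> V -> P) (z : U \ox V) :
  (forall u v, linear (fun w => b w u v)) ->
  linear (fun w => \tsum_(u, v <- z) b w u v).
Proof.
move=> hb a x y /=.
rewrite (linear_tsum _ _ (f := *:%R a)); last exact: linearP.
by rewrite -tsumDf; apply: eq_tsum => u v; apply: hb.
Qed.

Lemma tsum_tmap (U U' V V' P : lmodType K) (b : U' -> V' -> P)
    (f : U -> U') (h : V -> V') (z : U \ox V) :
  (forall v, linear (b^~ v)) -> (forall u, linear (b u)) ->
  \tsum_(x, y <- tmap f h z) b x y = \tsum_(u, v <- z) b (f u) (h v).
Proof.
move=> bl br; refine (eq_trans (linear_tsum _ _ (tsumK_linear bl br)) _).
by apply: eq_tsum => u v; rewrite tsumK_pure.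
Qed.

Lemma tsum_tassoc (U V W P : lmodType K) (b : U -> V \ox W -> P)
    (z : (U \ox V) \ox W) :
  (forall v, linear (b^~ v)) -> (forall u, linear (b u)) ->
  \tsum_(u, x <- tassoc z) b u x =
  \tsum_(x, w <- z) \tsum_(u, v <- x) b u (v \ot w).
Proof.
move=> bl br; have h1 := linear_tsum (fun (x : U \ox V) (w : W) => \tsum_(u, v <- x) u \ot (v \ot w)) z
  (tsumK_linear bl br).
refine (eq_trans h1 _); apply: eq_tsum => x w.
have h2 := linear_tsum (fun (u : U) (v : V) => u \ot (v \ot w)) x (tsumK_linear bl br).
refine (eq_trans h2 _).
by apply: eq_tsum => u v; rewrite tsumK_pure.
Qed.

Lemma tmap_id (U V : lmodType K) (z : U \ox V) : tmap id id z = z.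
Proof. exact: (esym (tensE z)). Qed.

Lemma tmap_comp (U U' U'' V V' V'' : lmodType K) (f : U' -> U'') (h : V' -> V'')
    (f' : U -> U') (h' : V -> V') (z : U \ox V) : linear f -> linear h ->
  tmap f h (tmap f' h' z) = tmap (f \o f') (h \o h') z.
Proof.
move=> lf lh; apply: (@tsum_tmap U U' V V' (U'' \ox V'')) => [v|u] a x y.
  by rewrite lf tpureK_linl.
by rewrite lh tpureK_linr.
Qed.

Lemma tmapPr (U U' V V' : lmodType K) (k : U -> U') (a : K) (f h : V -> V')
    (z : U \ox V) :
  tmap k (fun v => a *: f v + h v) z = a *: tmap k f z + tmap k h z.
Proof.
have la : linear (fun t : U' \ox V' => a *: t) by apply: linearP.
have e := linear_tsum (fun u v => k u \ot f v) z la.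
refine (eq_trans _ (congr1 (+%R^~ (tmap k h z)) (esym e))).
rewrite /tmap -tsumDf; apply: eq_tsum => u v; exact: tpureK_linr.
Qed.

Lemma tmapPl (U U' V V' : lmodType K) (k : V -> V') (a : K) (f h : U -> U')
    (z : U \ox V) :
  tmap (fun u => a *: f u + h u) k z = a *: tmap f k z + tmap h k z.
Proof.
have la : linear (fun t : U' \ox V' => a *: t) by apply: linearP.
have e := linear_tsum (fun u v => f u \ot k v) z la.
refine (eq_trans _ (congr1 (+%R^~ (tmap h k z)) (esym e))).
rewrite /tmap -tsumDf; apply: eq_tsum => u v; exact: tpureK_linl.
Qed.

Lemma tmapZr (U U' V V' : lmodType K) (k : U -> U') (a : K) (f : V -> V')
    (z : U \ox V) :
  tmap k (fun v => a *: f v) z = a *: tmap k f z.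
Proof.
have la : linear (fun t : U' \ox V' => a *: t) by apply: linearP.
have e := linear_tsum (fun u v => k u \ot f v) z la.
refine (eq_trans _ (esym e)); apply: eq_tsum => u v.
exact: (linear_eqs (tpureK_linr (k u))).2.
Qed.

Lemma tmapZl (U U' V V' : lmodType K) (k : V -> V') (a : K) (f : U -> U')
    (z : U \ox V) :
  tmap (fun u => a *: f u) k z = a *: tmap f k z.
Proof.
have la : linear (fun t : U' \ox V' => a *: t) by apply: linearP.
have e := linear_tsum (fun u v => f u \ot k v) z la.
refine (eq_trans _ (esym e)); apply: eq_tsum => u v.
exact: (linear_eqs (tpureK_linl (k v))).2.
Qed.

Lemma tassoc_linear (U V W : lmodType K) :
  linear (@tassoc U V W).
Proof.
apply: tsumK_linear => [w|x].
  apply: tsumK_linear => [v|u] a x y; first exact: tpureK_linl.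
  by rewrite tpureK_linl tpureK_linr.
apply: tsum_lin_param => u v a y z.
by rewrite tpureK_linr tpureK_linr.
Qed.

Lemma eq_tsum_linear (U V P : lmodType K) (f h : U \ox V -> P) :
  linear f -> linear h -> (forall u v, f (u \ot v) = h (u \ot v)) -> f =1 h.
Proof.
move=> lf lh e; elim/tensor_ind => [|u v z IH].
  have l0 (k : U \ox V -> P) : linear k -> k 0 = 0.
    by move=> lk; rewrite -[X in k X](scale0r 0) (linear_eqs lk).2 scale0r.
  by rewrite l0 // l0.
by rewrite (linear_eqs lf).1 (linear_eqs lh).1 IH -[tpure _ _ u v]/(u \ot v) e.
Qed.
End TensorMaps.

(* A K-algebra is a ring with a ring homomorphism from K to its centre. Unlike
   the library's algType this allows the zero ring: C may be zero below. *)
HB.mixin Record isKAlgebra (K : comPzRingType) A of GRing.PzRing A := {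
  inK : K -> A;
  inK_add : forall a b, inK (a + b) = inK a + inK b;
  inK_mul : forall a b, inK (a * b) = inK a * inK b;
  inK_1 : inK 1 = 1;
  inK_central : forall a x, inK a * x = x * inK a
}.

#[short(type="kalgType")]
HB.structure Definition KAlgebra (K : comPzRingType) :=
  {A of isKAlgebra K A & GRing.PzRing A}.

HB.mixin Record isCoalgebra (K : comPzRingType) C of GRing.Lmodule K C := {
  comul : C -> tensK C C;
  counit : C -> K^o;
  comul_linear : linear comul;
  counit_linear : linear counit;
  comulA : forall c, tassoc (tmap comul id (comul c)) = tmap id comul (comul c);
  counitl : forall c, \tsum_(c1, c2 <- comul c) counit c1 *: c2 = c;
  counitr : forall c, \tsum_(c1, c2 <- comul c) counit c2 *: c1 = c
}.

#[short(type="coalgType")]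
HB.structure Definition Coalgebra (K : comPzRingType) :=
  {C of isCoalgebra K C & GRing.Lmodule K C}.

Notation "'\Delta'" := comul : ring_scope.
Notation "'\eps'" := counit : ring_scope.

Section Klin.
Context (K : comPzRingType) (U V : lmodType K).

Record klin := Klin { klin_fun :> U -> V; _ : `[< linear klin_fun >] }.

HB.instance Definition _ := [isSub for klin_fun].
HB.instance Definition _ := [Choice of klin by <:].

Fact klin_closed : subsemimod_closed [pred f : U -> V | `[< linear f >]].
Proof.
split=> [|a f /asboolP lf]; last first.
  apply/asboolP => b x y.
  rewrite -[LHS]/(a *: f (b *: x + y)) -[RHS]/(b *: (a *: f x) + a *: f y).
  by rewrite lf scalerDr !scalerA mulrC.
split=> [|f h /asboolP lf /asboolP lh].
  by apply/asboolP => b x y /=; rewrite scaler0 addr0.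
apply/asboolP => b x y.
rewrite -[LHS]/(f (b *: x + y) + h (b *: x + y)).
rewrite -[RHS]/(b *: (f x + h x) + (f y + h y)).
by rewrite lf lh scalerDr addrACA.
Qed.

HB.instance Definition _ :=
  GRing.SubChoice_isSubLmodule.Build K (U -> V) _ klin klin_closed.

Lemma klin_linear (f : klin) : linear f.
Proof. by case: f => f /= /asboolP. Qed.

HB.instance Definition _ (f : klin) :=
  GRing.isLinear.Build K U V _ (klin_fun f) (klin_linear f).

Definition mkklin (f : U -> V) (lf : linear f) : klin := Klin (asboolT lf).
End Klin.

Section Endo.
Context (K : comPzRingType) (U : lmodType K).

Definition endo : Type := klin U U.
HB.instance Definition _ := GRing.Lmodule.on endo.

Fact endo_one_subproof : linear (@id U). Proof. by []. Qed.
Fact endo_mul_subproof (f h : endo) : linear (klin_fun f \o klin_fun h).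
Proof. by move=> a x y /=; rewrite !linearP. Qed.
Fact endo_inK_subproof (a : K) : linear (fun x : U => a *: x).
Proof. exact: linearP. Qed.

Definition endo_one : endo := mkklin endo_one_subproof.
Definition endo_mul (f h : endo) : endo := mkklin (endo_mul_subproof f h).
Definition endo_inK (a : K) : endo := mkklin (endo_inK_subproof a).

Lemma endoP (f h : endo) : (forall x, klin_fun f x = klin_fun h x) -> f = h.
Proof. by move=> e; apply/val_inj/funext. Qed.

Fact endo_mulA : associative endo_mul. Proof. by move=> f h k; apply/endoP. Qed.
Fact endo_mul1l : left_id endo_one endo_mul. Proof. by move=> f; apply/endoP. Qed.
Fact endo_mul1r : right_id endo_one endo_mul. Proof. by move=> f; apply/endoP. Qed.
Fact endo_mulDl : left_distributive endo_mul +%R.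
Proof. by move=> f h k; apply/endoP. Qed.
Fact endo_mulDr : right_distributive endo_mul +%R.
Proof. by move=> f h k; apply/endoP => x; apply: (linearD f). Qed.

HB.instance Definition _ := GRing.Zmodule_isPzRing.Build endo
  endo_mulA endo_mul1l endo_mul1r endo_mulDl endo_mulDr.

Fact endo_inK_add a b : endo_inK (a + b) = endo_inK a + endo_inK b.
Proof. by apply/endoP => x; apply: scalerDl. Qed.
Fact endo_inK_mul a b : endo_inK (a * b) = endo_inK a * endo_inK b.
Proof. by apply/endoP => x; apply/esym/scalerA. Qed.
Fact endo_inK_1 : endo_inK 1 = 1.
Proof. by apply/endoP => x; apply: scale1r. Qed.
Fact endo_inK_central a (f : endo) : endo_inK a * f = f * endo_inK a.
Proof. by apply/endoP => x; apply/esym/(linear_eqs (klin_linear f)).2. Qed.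

HB.instance Definition _ := isKAlgebra.Build K endo
  endo_inK_add endo_inK_mul endo_inK_1 endo_inK_central.
End Endo.

Section Dual.
Context (K : comPzRingType) (C : coalgType K).

Definition codual : Type := klin C K^o.
HB.instance Definition _ := GRing.Lmodule.on codual.

Fact dual_mul_subproof (f h : codual) :
  linear (fun c : C => \tsum_(c1, c2 <- \Delta c) (f c1 * h c2) : K^o).
Proof.
move=> a x y; rewrite comul_linear.
apply: (tsumK_linear (P := K^o)) => [v|u] b z t.
  by rewrite linearP mulrDl; congr (_ + _); apply/esym/mulrA.
by rewrite linearP mulrDr; congr (_ + _); apply: (@mulrCA K).
Qed.

Definition dual_one : codual := mkklin (@counit_linear K C).
Definition dual_mul (f h : codual) : codual := mkklin (dual_mul_subproof f h).

Lemma dualP (f h : codual) : (forall c, klin_fun f c = klin_fun h c) -> f = h.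
Proof. by move=> e; apply/val_inj/funext. Qed.

Fact dual_mulA : associative dual_mul.
Proof.
move=> f h k; apply/dualP => c.
have lr (m : codual) (u : K^o) : linear (fun v : C => m v * u : K^o).
  by move=> a x y; rewrite linearP mulrDl; congr (_ + _); apply/esym/mulrA.
have ll (m : codual) (u : K^o) : linear (fun v : C => u * m v : K^o).
  by move=> a x y; rewrite linearP mulrDr; congr (_ + _); apply: (@mulrCA K).
have lin (u : K^o) : linear (fun z : K^o => u * z).
  by move=> a x y; rewrite mulrDr; congr (_ + _); apply: (@mulrCA K).
pose hk (w : C \ox C) : K^o := \tsum_(v, x <- w) (h v * k x : K^o).
have lhk : linear hk by apply: tsumK_linear => ?; [apply: lr | apply: ll].
pose b (u : C) (w : C \ox C) : K^o := f u * hk w.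
have bl w : linear (b^~ w) by apply: lr.
have br u : linear (b u).
  by move=> a x y; rewrite /b lhk; apply: lin.
have := congr1 (fun z => \tsum_(u, w <- z) b u w) (comulA c).
rewrite /= tsum_tassoc // (tsum_tmap _ _ _ bl br) => e.
refine (eq_trans (esym e) _) => {e}.
refine (eq_trans (@tsum_tmap K C (tensK C C) C C K^o
  (fun x w => \tsum_(u, v <- x) b u (v \ot w)) comul id (comul c) _ _) _).
- move=> w; apply: tsumK_linear => [v|u] a x y; first exact: bl.
  by rewrite tpureK_linl br.
- move=> z; apply: tsum_lin_param => u v a x y.
  by rewrite tpureK_linr br.
apply: eq_tsum => u v.
rewrite -[RHS]/(dual_mul f h u * k v).
refine (eq_trans _ (esym (linear_tsum _ _ (f := fun z : K^o => z * k v) _))); last first.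
  by move=> a x y; rewrite mulrDl; congr (_ + _); apply/esym/mulrA.
apply: eq_tsum => u1 u2; rewrite /b /hk tsumK_pure ?mulrA //.
Qed.

Fact dual_mul1l : left_id dual_one dual_mul.
Proof.
move=> f; apply/dualP => c; rewrite -[RHS](congr1 f (counitl c)).
rewrite (linear_tsum _ _ (klin_linear f)).
by apply: eq_tsum => u v; rewrite (linear_eqs (klin_linear f)).2.
Qed.
Fact dual_mul1r : right_id dual_one dual_mul.
Proof.
move=> f; apply/dualP => c; rewrite -[RHS](congr1 f (counitr c)).
rewrite (linear_tsum _ _ (klin_linear f)).
by apply: eq_tsum => u v; rewrite (linear_eqs (klin_linear f)).2; apply: (@mulrC K).
Qed.
Fact dual_mulDl : left_distributive dual_mul +%R.
Proof.
move=> f h k; apply/dualP => x.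
rewrite -[RHS]/(dual_mul f k x + dual_mul h k x) -tsumDf.
by apply: eq_tsum => u v; apply: mulrDl.
Qed.
Fact dual_mulDr : right_distributive dual_mul +%R.
Proof.
move=> f h k; apply/dualP => x.
rewrite -[RHS]/(dual_mul f h x + dual_mul f k x) -tsumDf.
by apply: eq_tsum => u v; apply: mulrDr.
Qed.

HB.instance Definition _ := GRing.Zmodule_isPzRing.Build codual
  dual_mulA dual_mul1l dual_mul1r dual_mulDl dual_mulDr.

Definition dual_inK (a : K) : codual := a *: dual_one.

Lemma dual_scaleAl a (f h : codual) : a *: (f * h) = (a *: f) * h.
Proof.
apply/dualP => c; refine (eq_trans (linear_tsum _ _ (f := *:%R a) _) _).
  exact: linearP.
by apply: eq_tsum => u v; apply: (@mulrA K).
Qed.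
Lemma dual_scaleAr a (f h : codual) : a *: (f * h) = f * (a *: h).
Proof.
apply/dualP => c; refine (eq_trans (linear_tsum _ _ (f := *:%R a) _) _).
  exact: linearP.
by apply: eq_tsum => u v; apply: (@mulrCA K).
Qed.
Fact dual_inK_add a b : dual_inK (a + b) = dual_inK a + dual_inK b.
Proof. exact: scalerDl. Qed.
Fact dual_inK_mul a b : dual_inK (a * b) = dual_inK a * dual_inK b.
Proof. by rewrite /dual_inK -dual_scaleAl mul1r scalerA. Qed.
Fact dual_inK_1 : dual_inK 1 = 1.
Proof. exact: scale1r. Qed.
Fact dual_inK_central a (f : codual) : dual_inK a * f = f * dual_inK a.
Proof. by rewrite /dual_inK -dual_scaleAl -dual_scaleAr mul1r mulr1. Qed.

HB.instance Definition _ := isKAlgebra.Build K codual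
  dual_inK_add dual_inK_mul dual_inK_1 dual_inK_central.
End Dual.

Section Bicomodules.
Context (K : comPzRingType) (D C : coalgType K).

(* The carrier and the two coactions of a D-C-bicomodule. *)
Record bicomod_data := BicomodData {
  bicomod_sort :> lmodType K;
  lcoact : bicomod_sort -> D \ox bicomod_sort;
  rcoact : bicomod_sort -> bicomod_sort \ox C
}.

Record bicomodule (X : bicomod_data) : Prop := Bicomodule {
  lcoact_linear : linear (@lcoact X);
  rcoact_linear : linear (@rcoact X);
  lcoactA : forall x : X,
    tassoc (tmap \Delta id (lcoact x)) = tmap id (@lcoact X) (lcoact x);
  rcoactA : forall x : X,
    tassoc (tmap (@rcoact X) id (rcoact x)) = tmap id \Delta (rcoact x);
  lcoact1 : forall x : X, \tsum_(d, y <- lcoact x) (\eps d : K) *: y = x;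
  rcoact1 : forall x : X, \tsum_(y, c <- rcoact x) (\eps c : K) *: y = x;
  lrcoactA : forall x : X,
    tassoc (tmap (@lcoact X) id (rcoact x)) = tmap id (@rcoact X) (lcoact x)
}.

Record bicomod_hom (X Y : bicomod_data) (f : X -> Y) : Prop := BicomodHom {
  bicomod_hom_linear : linear f;
  bicomod_hom_l : forall x, lcoact (f x) = tmap id f (lcoact x);
  bicomod_hom_r : forall x, rcoact (f x) = tmap f id (rcoact x)
}.

Definition bicomod_iso (X Y : bicomod_data) : Prop :=
  exists2 f : X -> Y, bicomod_hom f & bijective f.

Definition bicomod_sum (X Y : bicomod_data) : bicomod_data :=
  @BicomodData (X * Y)%type
    (fun p => tmap id (fun x => (x, 0)) (lcoact p.1)
            + tmap id (fun y => (0, y)) (lcoact p.2))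
    (fun p => tmap (fun x => (x, 0)) id (rcoact p.1)
            + tmap (fun y => (0, y)) id (rcoact p.2)).

Definition bicomod_pow (X : bicomod_data) (N : nat) : bicomod_data :=
  let inj i (x : X) := [ffun j : 'I_N => if j == i then x else 0] in
  @BicomodData {ffun 'I_N -> X}
    (fun v => \sum_i tmap id (inj i) (lcoact (v i)))
    (fun v => \sum_i tmap (inj i) id (rcoact (v i))).

Definition direct_summand (X Y : bicomod_data) : Prop :=
  exists2 M : bicomod_data, bicomodule M & bicomod_iso (bicomod_sum X M) Y.
End Bicomodules.

Section Cotensor.
Context (K : comPzRingType) (C D : coalgType K) (g : {linear C -> D}).

Definition coalgebra_hom : Prop :=
  (forall c, \Delta (g c) = tmap g g (\Delta c)) /\
  (forall c, \eps (g c) = \eps c).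

Definition glcoact (c : C) : D \ox C := tmap g id (\Delta c).
Definition grcoact (c : C) : C \ox D := tmap id g (\Delta c).

Lemma glcoact_linear : linear glcoact.
Proof.
by move=> a x y; rewrite /glcoact comul_linear tmap_linear //; apply: linearP.
Qed.
Lemma grcoact_linear : linear grcoact.
Proof.
by move=> a x y; rewrite /grcoact comul_linear tmap_linear //; apply: linearP.
Qed.

(* C [box]_D C, as a K-submodule of C (x) C. *)
Definition cot_pred : pred (C \ox C) :=
  fun z => tassoc (tmap grcoact id z) == tmap id glcoact z.

Record cot := Cot { cot_val : C \ox C; _ : cot_pred cot_val }.
HB.instance Definition _ := [isSub for cot_val].
HB.instance Definition _ := [Choice of cot by <:].

Fact cot_closed : subsemimod_closed cot_pred.
Proof.
have ll : linear (fun z : C \ox C => tassoc (tmap grcoact id z)).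
  apply: (linear_comp (@tassoc_linear K C D C)).
  by apply: tmap_linear; [apply: grcoact_linear | move=> ?].
have lr : linear (fun z : C \ox C => tmap id glcoact z).
  by apply: tmap_linear; [move=> ? | apply: glcoact_linear].
have l0 (f : C \ox C -> C \ox (D \ox C)) : linear f -> f 0 = 0.
  by move=> lf; rewrite -[X in f X](scale0r 0) (linear_eqs lf).2 scale0r.
split=> [|a x /eqP hx]; last first.
  by apply/eqP; rewrite (linear_eqs ll).2 (linear_eqs lr).2 hx.
split=> [|x y /eqP hx /eqP hy].
  by apply/eqP; rewrite (l0 _ ll) (l0 _ lr).
by apply/eqP; rewrite (linear_eqs ll).1 (linear_eqs lr).1 hx hy.
Qed.
HB.instance Definition _ :=
  GRing.SubChoice_isSubLmodule.Build K (C \ox C) _ cot cot_closed.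
End Cotensor.

Section Codepth.
Context (K : comPzRingType) (C D : coalgType K) (g : {linear C -> D}).

(* C (x) (C [box]_D C) -> C (x) (C (x) C) is injective as C is flat; [cot_lift_r]
   is its inverse on its image. Likewise for [cot_lift_l]. *)
Definition cot_lift_r (w : C \ox (C \ox C)) : C \ox cot g :=
  xget 0 [set z | tmap id (@cot_val _ _ _ g) z = w]%classic.
Definition cot_lift_l (w : (C \ox C) \ox C) : cot g \ox C :=
  xget 0 [set z | tmap (@cot_val _ _ _ g) id z = w]%classic.

(* Delta (x) C and C (x) Delta on C [box]_D C. *)
Definition cot_lco (x : cot g) : C \ox cot g :=
  cot_lift_r (tassoc (tmap \Delta id (cot_val x))).
Definition cot_rco (x : cot g) : cot g \ox C :=
  cot_lift_l (tassocV (tmap id \Delta (cot_val x))).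

Definition cot_bicomod : bicomod_data D C :=
  @BicomodData K D C (cot g) (fun x => tmap g id (cot_lco x)) cot_rco.
Definition bicomod_DCC : bicomod_data D C :=
  @BicomodData K D C C (glcoact g) \Delta.
Definition bicomod_DCD : bicomod_data D D :=
  @BicomodData K D D C (glcoact g) (grcoact g).

Definition left_codepth_two : Prop :=
  exists2 N, (0 < N)%N & direct_summand cot_bicomod (bicomod_pow bicomod_DCC N).
End Codepth.

Section EndCent.
Context (K : comPzRingType) (C D : coalgType K) (g : {linear C -> D}).

(* E = End(^D C^D), an algebra under composition. *)
Definition bicEnd_pred : pred (endo C) :=
  fun f => `[< @bicomod_hom K D D (bicomod_DCD g) (bicomod_DCD g) f >].

Record bicEnd := BicEnd { bicEnd_val : endo C; _ : bicEnd_pred bicEnd_val }.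
HB.instance Definition _ := [isSub for bicEnd_val].
HB.instance Definition _ := [Choice of bicEnd by <:].

Definition bicEnd_fun (f : bicEnd) : C -> C := klin_fun (bicEnd_val f).

Fact bicEnd_closed : subring_closed bicEnd_pred.
Proof.
have gl := glcoact_linear g; have gr := grcoact_linear g.
split=> [|f h /asboolP [lf fl fr] /asboolP [lh hl hr]|
         f h /asboolP [lf fl fr] /asboolP [lh hl hr]]; apply/asboolP.
- split=> [|c|c]; first exact: linearP.
    exact: esym (tmap_id _).
  exact: esym (tmap_id _).
- have e x : (f - h) x = -1 *: h x + f x by rewrite scaleN1r addrC.
  have -> : klin_fun (f - h) = fun x => -1 *: h x + f x by apply/funext.
  split=> [a x y|c|c]; first by rewrite -!e linearP.
    rewrite /= gl tmapPr -[glcoact g (h c)]/(lcoact (h c : bicomod_DCD g)).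
    by rewrite hl -[glcoact g (f c)]/(lcoact (f c : bicomod_DCD g)) fl.
  rewrite /= gr tmapPl -[grcoact g (h c)]/(rcoact (h c : bicomod_DCD g)).
  by rewrite hr -[grcoact g (f c)]/(rcoact (f c : bicomod_DCD g)) fr.
have idl : linear (@id D) by [].
split=> [|c|c]; first exact: linearP.
  refine (eq_trans (fl (h c)) _).
  refine (eq_trans (congr1 _ (hl c)) _).
  exact: (tmap_comp _ _ _ idl lf).
refine (eq_trans (fr (h c)) _).
refine (eq_trans (congr1 _ (hr c)) _).
exact: (tmap_comp _ _ _ lf idl).
Qed.
HB.instance Definition _ :=
  GRing.SubChoice_isSubPzRing.Build (endo C) _ bicEnd bicEnd_closed.

Fact bicEnd_inK_subproof (a : K) : bicEnd_pred (inK a).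
Proof.
apply/asboolP; split=> [|c|c]; first exact: linearP.
  refine (eq_trans ((linear_eqs (glcoact_linear g)).2 a c) _).
  by refine (esym (eq_trans (tmapZr id a id _) _)); rewrite tmap_id.
refine (eq_trans ((linear_eqs (grcoact_linear g)).2 a c) _).
by refine (esym (eq_trans (tmapZl id a id _) _)); rewrite tmap_id.
Qed.
Definition bicEnd_inK (a : K) : bicEnd := BicEnd (bicEnd_inK_subproof a).

Fact bicEnd_inK_add a b : bicEnd_inK (a + b) = bicEnd_inK a + bicEnd_inK b.
Proof. by apply/val_inj/inK_add. Qed.
Fact bicEnd_inK_mul a b : bicEnd_inK (a * b) = bicEnd_inK a * bicEnd_inK b.
Proof. by apply/val_inj/inK_mul. Qed.
Fact bicEnd_inK_1 : bicEnd_inK 1 = 1.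
Proof. by apply/val_inj/inK_1. Qed.
Fact bicEnd_inK_central a f : bicEnd_inK a * f = f * bicEnd_inK a.
Proof. by apply/val_inj/inK_central. Qed.
HB.instance Definition _ := isKAlgebra.Build K bicEnd
  bicEnd_inK_add bicEnd_inK_mul bicEnd_inK_1 bicEnd_inK_central.

(* g^* : D^* -> C^*. *)
Fact gdual_subproof (d : codual D) : linear (fun c : C => d (g c)).
Proof. by apply: linear_comp; apply: linearP. Qed.
Definition gdual (d : codual D) : codual C := mkklin (gdual_subproof d).

(* R, the centralizer of g^*(D^* ) in C^*. *)
Definition dualCent_pred : pred (codual C) :=
  fun f => `[< forall d : codual D, f * gdual d = gdual d * f >].

Record dualCent := DualCent { dualCent_val : codual C; _ : dualCent_pred dualCent_val }.
HB.instance Definition _ := [isSub for dualCent_val].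
HB.instance Definition _ := [Choice of dualCent by <:].

Definition dualCent_fun (f : dualCent) : C -> K^o := klin_fun (dualCent_val f).

Fact dualCent_closed : subring_closed dualCent_pred.
Proof.
split=> [|f h /asboolP hf /asboolP hh|f h /asboolP hf /asboolP hh].
- by apply/asboolP => d; rewrite mul1r mulr1.
- by apply/asboolP => d; rewrite mulrBl mulrBr hf hh.
by apply/asboolP => d; rewrite -mulrA hh mulrA hf mulrA.
Qed.
HB.instance Definition _ :=
  GRing.SubChoice_isSubPzRing.Build (codual C) _ dualCent dualCent_closed.

Fact dualCent_inK_subproof (a : K) : dualCent_pred (inK a).
Proof. by apply/asboolP => d; apply: inK_central. Qed.
Definition dualCent_inK (a : K) : dualCent := DualCent (dualCent_inK_subproof a).

Fact dualCent_inK_add a b : dualCent_inK (a + b) = dualCent_inK a + dualCent_inK b.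
Proof. by apply/val_inj/inK_add. Qed.
Fact dualCent_inK_mul a b : dualCent_inK (a * b) = dualCent_inK a * dualCent_inK b.
Proof. by apply/val_inj/inK_mul. Qed.
Fact dualCent_inK_1 : dualCent_inK 1 = 1.
Proof. by apply/val_inj/inK_1. Qed.
Fact dualCent_inK_central a f : dualCent_inK a * f = f * dualCent_inK a.
Proof. by apply/val_inj/inK_central. Qed.
HB.instance Definition _ := isKAlgebra.Build K dualCent
  dualCent_inK_add dualCent_inK_mul dualCent_inK_1 dualCent_inK_central.
End EndCent.
Coercion bicEnd_fun : bicEnd >-> Funclass.
Coercion dualCent_fun : dualCent >-> Funclass.

Section Quasibases.
Context (K : comPzRingType) (C D : coalgType K) (g : {linear C -> D}).

(* Membership in (C [box]_D C)^{* D^*}. *)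
Definition cot_dual_cent (eta : klin (cot g) K^o) : Prop :=
  forall (d : codual D) (x : cot g),
    \tsum_(c, w <- cot_lco x) (d (g c) * eta w)
    = \tsum_(w, c <- cot_rco x) (eta w * d (g c)).

Record quasibases N (alpha : 'I_N -> bicEnd g) (eta : 'I_N -> klin (cot g) K^o)
    : Prop := Quasibases {
  quasibases_cent : forall i, cot_dual_cent (eta i);
  quasibases_eq : forall x : cot g,
    cot_val x = \sum_i \tsum_(w, c <- cot_rco x)
                  ((eta i w : K) *: tmap (alpha i) id (\Delta c))
}.
End Quasibases.

Section Bialgebroid.
Context (K : comPzRingType) (R E : kalgType K) (s t : R -> E).

(* E (x)_R E for the bimodule structure r.e.r' = e s(r') t(r). *)
Definition tensR : Type :=
  tensor (fun (e : E) (r : R) => e * s r) (fun (r : R) (e : E) => e * t r).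
HB.instance Definition _ := GRing.Zmodule.on tensR.

Definition tpureR (x y : E) : tensR :=
  tpure (fun (e : E) (r : R) => e * s r) (fun (r : R) (e : E) => e * t r) x y.

Definition bact (r : R) (e : E) (r' : R) : E := e * s r' * t r.
Definition bactR (r : R) (X : tensR) (r' : R) : tensR :=
  \tsum_(x, y <- X) tpureR (bact r x 1) (bact 1 y r').

(* E (x)_R (E (x)_R E) and (E (x)_R E) (x)_R E. *)
Definition tensR3 : Type :=
  tensor (fun (e : E) (r : R) => e * s r) (fun (r : R) (X : tensR) => bactR r X 1).
Definition tensR3' : Type :=
  tensor (fun (X : tensR) (r : R) => bactR 1 X r) (fun (r : R) (e : E) => e * t r).
HB.instance Definition _ := GRing.Zmodule.on tensR3.
HB.instance Definition _ := GRing.Zmodule.on tensR3'.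
Definition tpureR3 (x : E) (Y : tensR) : tensR3 := tpure _ _ x Y.
Definition tpureR3' (X : tensR) (y : E) : tensR3' := tpure _ _ X y.
Definition tassocR (Z : tensR3') : tensR3 :=
  \tsum_(X, z <- Z) \tsum_(x, y <- X) tpureR3 x (tpureR y z).

Definition takeuchi (X : tensR) : Prop := forall r : R,
  \tsum_(x, y <- X) tpureR (s r * x) y = \tsum_(x, y <- X) tpureR x (t r * y).

(* Independent of the representatives when X' is in E x_R E: [takeuchi_mulE]. *)
Definition takeuchi_mul (X X' : tensR) : tensR :=
  \tsum_(x, y <- X) \tsum_(x', y' <- X') tpureR (x * x') (y * y').

Record right_bialgebroid (Delta : E -> tensR) (eps : E -> R) : Prop :=
  RightBialgebroid {
  source_add : forall r r', s (r + r') = s r + s r';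
  source_mul : forall r r', s (r * r') = s r * s r';
  source_inK : forall a : K, s (inK a) = inK a;
  target_add : forall r r', t (r + r') = t r + t r';
  target_mul : forall r r', t (r * r') = t r' * t r;
  target_inK : forall a : K, t (inK a) = inK a;
  source_target : forall r r', s r * t r' = t r' * s r;
  Delta_add : forall e e', Delta (e + e') = Delta e + Delta e';
  Delta_bact : forall r e r', Delta (bact r e r') = bactR r (Delta e) r';
  eps_add : forall e e', eps (e + e') = eps e + eps e';
  eps_bact : forall r e r', eps (bact r e r') = r * eps e * r';
  Delta_coassoc : forall e,
    tassocR (\tsum_(x, y <- Delta e) tpureR3' (Delta x) y)
    = \tsum_(x, y <- Delta e) tpureR3 x (Delta y);
  Delta_counitl : forall e, \tsum_(x, y <- Delta e) bact (eps x) y 1 = e;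
  Delta_counitr : forall e, \tsum_(x, y <- Delta e) bact 1 x (eps y) = e;
  Delta_1 : Delta 1 = tpureR 1 1;
  eps_1 : eps 1 = 1;
  Delta_takeuchi : forall e, takeuchi (Delta e);
  Delta_mul : forall e e', Delta (e * e') = takeuchi_mul (Delta e) (Delta e');
  eps_mul_s : forall e e', eps (e * e') = eps (s (eps e) * e');
  eps_mul_t : forall e e', eps (e * e') = eps (t (eps e) * e')
}.

Lemma takeuchi_mulE (S S' : seq (E * E)) :
  takeuchi (\sum_(p <- S') tpureR p.1 p.2) ->
  takeuchi_mul (\sum_(p <- S) tpureR p.1 p.2) (\sum_(p <- S') tpureR p.1 p.2)
  = \sum_(p <- S) \sum_(p' <- S') tpureR (p.1 * p'.1) (p.2 * p'.2).
Proof.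
set X' := \sum_(p <- S') _ => hX'.
have hF x y : balanced (fun (e : E) (r : R) => e * s r)
    (fun (r : R) (e : E) => e * t r) (fun x' y' => tpureR (x * x') (y * y')).
  split=> [m m' n|m n n'|m a n].
  - by rewrite mulrDr /tpureR tpureDl.
  - by rewrite mulrDr /tpureR tpureDr.
  - by rewrite !mulrA /tpureR tpure_bal.
pose F x y (Z : tensR) := \tsum_(x', y' <- Z) tpureR (x * x') (y * y').
have FD x y (Z Z' : tensR) : F x y (Z + Z') = F x y Z + F x y Z'.
  exact: tsumD (hF x y) Z Z'.
have F0 x y : F x y 0 = 0 by apply: tsum0 (hF x y).
have Fsum x y (Q : seq (E * E)) (u v : E * E -> E) :
    F x y (\sum_(p <- Q) tpureR (u p) (v p)) =
    \sum_(p <- Q) tpureR (x * u p) (y * v p).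
  elim: Q => [|p Q IH]; first by rewrite !big_nil.
  by rewrite !big_cons FD IH; congr (_ + _); apply: tsum_pure (hF x y) _ _.
have hG : balanced (fun (e : E) (r : R) => e * s r)
    (fun (r : R) (e : E) => e * t r) (fun x y => F x y X').
  split=> [m m' n|m n n'|m a n].
  - rewrite /F -tsumDf; apply: eq_tsum => u v.
    by rewrite mulrDl /tpureR tpureDl.
  - rewrite /F -tsumDf; apply: eq_tsum => u v.
    by rewrite mulrDl /tpureR tpureDr.
  have e := congr1 (F m n) (hX' a); rewrite /tsum !Fsum in e.
  rewrite -[LHS]/(\sum_(p <- repr X') tpureR (m * s a * p.1) (n * p.2)).
  rewrite -[RHS]/(\sum_(p <- repr X') tpureR (m * p.1) (n * t a * p.2)).
  refine (eq_trans _ (eq_trans e _)); apply: eq_bigr => p _.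
    by rewrite mulrA.
  by rewrite mulrA.
have hS (Q : seq (E * E)) : takeuchi_mul (\sum_(p <- Q) tpureR p.1 p.2) X'
    = \sum_(p <- Q) F p.1 p.2 X'.
  elim: Q => [|p Q IH]; first by rewrite !big_nil; apply: tsum0 hG.
  rewrite !big_cons -IH; refine (eq_trans (tsumD hG _ _) _).
  by congr (_ + _); apply: tsum_pure hG _ _.
by rewrite hS; apply: eq_bigr => p _; rewrite Fsum.
Qed.
End Bialgebroid.

Section ModuleConditions.

Definition is_field (K : comPzRingType) : Prop :=
  (1 : K) != 0 /\ forall x : K, x != 0 -> exists y, x * y = 1.

Definition flat (K : comPzRingType) (M : lmodType K) : Prop :=
  forall (U V : lmodType K) (f : {linear U -> V}),
    injective f -> injective (tmap (@id M) f).

Definition dual_separates (K : comPzRingType) (M : lmodType K) : Prop :=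
  forall x : M, (forall f : klin M K^o, f x = 0) -> x = 0.

Definition base_assumption (K : comPzRingType) (C D : lmodType K) : Prop :=
  is_field K
  \/ [/\ flat C, flat D, dual_separates C & dual_separates D].

Context (R : pzRingType) (M : zmodType) (act : R -> M -> M).

Definition fin_gen : Prop :=
  exists n (e : 'I_n -> M),
    forall x, exists r : 'I_n -> R, x = \sum_i act (r i) (e i).

Definition module_hom (P : lmodType R) (h : M -> P) : Prop :=
  (forall x y, h (x + y) = h x + h y) /\ (forall r x, h (act r x) = r *: h x).

Definition projective : Prop :=
  forall (P Q : lmodType R) (f : {linear P -> Q}) (h : M -> Q),
    (forall q, exists p, f p = q) -> module_hom h ->
    exists2 h' : M -> P, module_hom h' & forall x, f (h' x) = h x.
End ModuleConditions.

(* Main.v *)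
Require Import Defs.
From HB Require Import structures.
From mathcomp Require Import all_boot all_order all_algebra generic_quotient.
From mathcomp Require Import boolp classical_sets functions.
Set Implicit Arguments.
Unset Strict Implicit.
Unset Printing Implicit Defensive.
Import GRing.Theory.
Local Open Scope ring_scope.

(** Write X for the cotensor product of C with itself over D, E for the
    D-D-bicomodule endomorphisms of C and R for the centralizer of D^* in C^*.

    Everything rests on evaluating elements of E (x)_R E along the
    comultiplication: [diag_eval] sends x (x) y to c |-> x(c1) (x) y(c2), a map
    from C to C (x) C. Quasibases alpha_i, eta_i make this evaluation injective
    ([diag_eval_inj]). Indeed for y in E the element y(c1) (x) c2 lies in X, so
    that r_i(y)(c) = eta_i(y(c1) (x) c2) defines an element of R, and the
    quasibase equation, evaluated at y(c1) (x) c2, reads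
    y = sum_i r_i(y) . alpha_i ([quasi_expand]). So the alpha_i and r_i form a
    dual basis of the left R-module E, which is therefore finitely generated
    projective; moreover sum_k x_k (x) y_k = sum_i e_i (x) alpha_i with
    e_i = sum_k x_k s(r_i(y_k)), and e_i can be computed from the values of
    [diag_eval] alone.

    The proposed comultiplication is the unique one whose evaluation at a is
    the composite of a and the comultiplication of C ([diag_eval_Delta]). This
    gives its independence of the quasibases, and turns the bialgebroid axioms
    into identities between maps out of C which follow from the coassociativity
    and the counit of C. Coassociativity in E (x)_R (E (x)_R E) is tested by
    taking coordinates of the last two factors, which leaves an identity in
    E (x)_R E ([bic_Delta_coassoc]).

    The module hypotheses enter in two ways. As C is flat, tensoring with C
    preserves the equalizer that defines X ([flat_equalizer]); hence X inherits
    coactions from C (x) C ([cot_lcoE], [cot_rcoE]). As C and D are flat,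
    identities in C (x) X and D (x) X can be checked in C (x) C (x) C and
    D (x) C (x) C. As functionals separate the points of D,
    the centralizer conditions, stated with functionals on D, are identities in
    D, and these make s(r), t(r) and the first tensorands of the comultiplication
    D-colinear on both sides. Over a field these hypotheses hold because
    injective linear maps have retractions ([field_retraction]).

    Finally, codepth two says that X is a retract of a power of C by bicolinear
    maps ([codepth_two_retract]); its components X -> C followed by the
    counit are the eta_i, and its components C -> X followed by the counit on
    the second tensorand are the alpha_i ([quasibases_exist]). *)

(** * Linear maps and sums over tensors *)

Section LinearCombinators.
Context (K : comPzRingType).
Implicit Types U V W P : lmodType K.

Lemma linear_id U : linear (fun x : U => x). Proof. by []. Qed.

Lemma linear_scalel U V (e : U -> K^o) (v : V) :
  linear e -> linear (fun x => (e x : K) *: v).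
Proof. by move=> le a x y; rewrite le scalerDl scalerA. Qed.

Lemma linear_scaler U V (a : K) (e : U -> V) :
  linear e -> linear (fun x => a *: e x).
Proof. by move=> le b x y; rewrite le scalerDr !scalerA mulrC. Qed.

Lemma linear_add U V (e f : U -> V) :
  linear e -> linear f -> linear (fun x => e x + f x).
Proof. by move=> le lf a x y; rewrite le lf scalerDr addrACA. Qed.

Lemma linear_big U V I (r : seq I) (e : I -> U -> V) :
  (forall i, linear (e i)) -> linear (fun x => \sum_(i <- r) e i x).
Proof.
move=> le a x y; rewrite scaler_sumr -big_split; apply: eq_bigr => i _.
exact: le.
Qed.

Lemma linear0_fun U V (f : U -> V) : linear f -> f 0 = 0.
Proof. by move=> lf; rewrite -(scale0r 0) (linear_eqs lf).2 scale0r. Qed.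

(** [tsum] with values in a K-module: recording the module structure of P, and
    not merely its group structure, lets rewriting rules infer it. *)
Definition lsum U V P (b : U -> V -> P) (z : U \ox V) : P := tsum b z.

Lemma linear_lsum_arg U V W P (b : U -> V -> P) (z : W -> U \ox V) :
  (forall v, linear (b^~ v)) -> (forall u, linear (b u)) -> linear z ->
  linear (fun w => lsum b (z w)).
Proof. by move=> bl br lz; apply: (linear_comp (tsumK_linear bl br)). Qed.

Lemma linear_lsum_param U V W P (b : W -> U -> V -> P) (z : U \ox V) :
  (forall u v, linear (fun w => b w u v)) ->
  linear (fun w => lsum (b w) z).
Proof. exact: tsum_lin_param. Qed.

Lemma linear_tmap_arg U V U' V' W (f : U -> U') (h : V -> V') (z : W -> U \ox V) :
  linear f -> linear h -> linear z -> linear (fun w => tmap f h (z w)).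
Proof. by move=> lf lh; apply: linear_comp; apply: tmap_linear. Qed.
End LinearCombinators.
Arguments lsum : simpl never.

Notation "\lsum_ ( x , y <- z ) E" := (lsum (fun x y => E) z)
  (at level 41, E at level 41, x, y at level 50,
   format "\lsum_ ( x ,  y  <-  z )  E") : ring_scope.

(** [lin] proves that an expression is linear in one variable, by recursion on
    the expression; goals of any other form are only beta-reduced. It replaces
    the remark that a formula in Sweedler notation is multilinear. *)
Ltac lin_atom :=
  first [ assumption
        | exact: linear_id
        | exact: tpureK_linl | exact: tpureK_linr
        | exact: comul_linear | exact: counit_linear
        | exact: tassoc_linear
        | exact: linearP
        | match goal with H : _ |- _ => exact: H end ].

(* Succeeds when the function [z] is constant: otherwise [z0] would mention the
   bound variable and could not be a closed term. *)
Ltac lin_const z :=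
  lazymatch z with fun x => ?z0 => let y := constr:(z0) in idtac end.

Ltac lin :=
  cbv beta;
  lazymatch goal with
  | |- GRing.linear_for _ _ => first [ solve [lin_atom] | lin_step ]
  | |- forall x, @?Q x => intro; lin
  | _ => idtac
  end
with lin_step :=
  lazymatch goal with
  | |- GRing.linear_for _ (tmap _ _) => apply: tmap_linear; lin
  | |- GRing.linear_for _ (lsum _) => apply: tsumK_linear; lin
  | |- GRing.linear_for _ (fun x => tmap (@?f x) (@?h x) (@?z x)) =>
      apply: linear_tmap_arg; lin
  | |- GRing.linear_for _ (fun x => lsum (@?b x) (@?z x)) =>
      tryif lin_const z then apply: linear_lsum_param; lin
      else (apply: linear_lsum_arg; lin)
  | |- GRing.linear_for _ (fun x => (@?a x) *: (@?e x)) =>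
      tryif lin_const a then apply: linear_scaler; lin
      else (apply: linear_scalel; lin)
  | |- GRing.linear_for _ (fun x => (@?e x) + (@?f x)) => apply: linear_add; lin
  | |- GRing.linear_for _ (fun x => \sum_(i <- _) _) => apply: linear_big; lin
  | |- _ => lin_app
  end
with lin_app :=
  match goal with
  | |- GRing.linear_for _ (fun x => ?F (@?e x)) => lin_comp F e
  | |- GRing.linear_for _ (fun x => ?F (@?e x) ?u) => lin_comp (fun y => F y u) e
  | |- GRing.linear_for _ (fun x => ?F (@?e x) ?u ?v) => lin_comp (fun y => F y u v) e
  | |- GRing.linear_for _ (fun x => ?F (@?e x) ?u ?v ?w) =>
      lin_comp (fun y => F y u v w) e
  end
with lin_comp F e :=
  lazymatch e with
  | (fun x => x) => fail
  | _ => refine (linear_comp (f := F) (h := e) _ _); lin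
  end.

Section TensorLemmas.
Context (K : comPzRingType).
Implicit Types U V W P Q M : lmodType K.

Lemma lsum_pure U V P (b : U -> V -> P) u v :
  (forall v, linear (b^~ v)) -> (forall u, linear (b u)) ->
  \lsum_(x, y <- u \ot v) b x y = b u v.
Proof. exact: tsumK_pure. Qed.

Lemma eq_lsum U V P (b b' : U -> V -> P) z :
  (forall u v, b u v = b' u v) -> lsum b z = lsum b' z.
Proof. exact: eq_tsum. Qed.

Lemma linear_lsum U V P Q (f : P -> Q) (b : U -> V -> P) z : linear f ->
  f (\lsum_(u, v <- z) b u v) = \lsum_(u, v <- z) f (b u v).
Proof. exact: linear_tsum. Qed.

Lemma lsumZ U V P a (b : U -> V -> P) z :
  a *: (\lsum_(u, v <- z) b u v) = \lsum_(u, v <- z) (a *: b u v).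
Proof. by apply: (linear_lsum (f := fun x => a *: x)); lin. Qed.

Lemma lsum_scalel U V P (b : U -> V -> K^o) z (x : P) :
  (\lsum_(u, v <- z) b u v : K) *: x = \lsum_(u, v <- z) ((b u v : K) *: x).
Proof. by apply: (linear_lsum (f := fun a : K^o => (a : K) *: x)); lin. Qed.

Lemma tmapE U U' V V' (f : U -> U') (h : V -> V') z :
  tmap f h z = \lsum_(u, v <- z) (f u \ot h v).
Proof. by []. Qed.

Lemma lsum_id U V P (f : U \ox V -> P) z : linear f ->
  \lsum_(u, v <- z) f (u \ot v) = f z.
Proof. by move=> lf; rewrite -linear_lsum // -tmapE tmap_id. Qed.

Lemma lsum_tmap U U' V V' P (b : U' -> V' -> P) (f : U -> U') (h : V -> V') z :
  (forall v, linear (b^~ v)) -> (forall u, linear (b u)) ->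
  \lsum_(x, y <- tmap f h z) b x y = \lsum_(u, v <- z) b (f u) (h v).
Proof. exact: tsum_tmap. Qed.

Lemma lsum_tassoc U V W P (b : U -> V \ox W -> P) z :
  (forall v, linear (b^~ v)) -> (forall u, linear (b u)) ->
  \lsum_(u, x <- tassoc z) b u x =
  \lsum_(x, w <- z) \lsum_(u, v <- x) b u (v \ot w).
Proof. exact: tsum_tassoc. Qed.

Lemma exchange_lsum U V U' V' P (b : U -> V -> U' -> V' -> P)
    (z : U \ox V) (z' : U' \ox V') :
  \lsum_(u, v <- z) \lsum_(u', v' <- z') b u v u' v' =
  \lsum_(u', v' <- z') \lsum_(u, v <- z) b u v u' v'.
Proof. exact: exchange_big. Qed.

Lemma tassocE U V W (z : (U \ox V) \ox W) :
  tassoc z = \lsum_(x, w <- z) \lsum_(u, v <- x) (u \ot (v \ot w)).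
Proof. by []. Qed.

Lemma tassocVE U V W (z : U \ox (V \ox W)) :
  tassocV z = \lsum_(u, y <- z) \lsum_(v, w <- y) ((u \ot v) \ot w).
Proof. by []. Qed.

Lemma tassocV_linear U V W : linear (@tassocV K U V W).
Proof.
suff: linear (fun z : U \ox (V \ox W) =>
    \lsum_(u, y <- z) \lsum_(v, w <- y) ((u \ot v) \ot w)) by [].
by lin.
Qed.

Definition tswap U V (z : U \ox V) : V \ox U := \lsum_(u, v <- z) (v \ot u).

Lemma tswap_linear U V : linear (@tswap U V).
Proof. by rewrite /tswap; lin. Qed.

Lemma tswap_pure U V (u : U) (v : V) : tswap (u \ot v) = v \ot u.
Proof. by rewrite /tswap lsum_pure; lin. Qed.

Lemma tswapK U V : cancel (@tswap U V) (@tswap V U).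
Proof.
have l := tswap_linear.
by apply: eq_tsum_linear => [||u v]; rewrite /= ?tswap_pure //; lin.
Qed.

Lemma tmap_pure U U' V V' (f : U -> U') (h : V -> V') u v :
  linear f -> linear h -> tmap f h (u \ot v) = f u \ot h v.
Proof. by move=> lf lh; rewrite tmapE lsum_pure //; lin. Qed.

Lemma tmap_swap U U' V V' (f : U -> U') (h : V -> V') z :
  linear f -> linear h -> tmap f h z = tswap (tmap h f (tswap z)).
Proof.
move=> lf lh; have l := tswap_linear; move: z.
apply: eq_tsum_linear => [||u v]; [by lin|by lin|].
by rewrite /= tswap_pure !tmap_pure // tswap_pure.
Qed.

Lemma tassoc_pure U V W (u : U) (v : V) (w : W) :
  tassoc ((u \ot v) \ot w) = u \ot (v \ot w).
Proof. by rewrite tassocE !lsum_pure //; lin. Qed.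

Lemma tassocV_pure U V W (u : U) (v : V) (w : W) :
  tassocV (u \ot (v \ot w)) = (u \ot v) \ot w.
Proof. by rewrite tassocVE !lsum_pure //; lin. Qed.

Lemma eq_linear3 U V W P (f h : U \ox (V \ox W) -> P) : linear f -> linear h ->
  (forall u v w, f (u \ot (v \ot w)) = h (u \ot (v \ot w))) -> f =1 h.
Proof.
move=> lf lh e; apply: eq_tsum_linear => // u x; move: x.
by apply: eq_tsum_linear => [||v w]; [lin|lin|exact: e].
Qed.

Lemma lsum_tassocV U V W P (b : U \ox V -> W -> P) (z : U \ox (V \ox W)) :
  (forall w, linear (b^~ w)) -> (forall x, linear (b x)) ->
  \lsum_(x, w <- tassocV z) b x w =
  \lsum_(u, y <- z) \lsum_(v, w <- y) b (u \ot v) w.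
Proof.
move=> bl br; have l := tassocV_linear; move: z.
by apply: eq_linear3 => [||u v w]; [lin|lin|rewrite tassocV_pure !lsum_pure //; lin].
Qed.
End TensorLemmas.

(** * Flatness and exactness *)

Section Flatness.
Context (K : comPzRingType).
Implicit Types U V W P Q M : lmodType K.

Lemma flat_injl M U V (f : U -> V) : flat M -> linear f -> injective f ->
  injective (tmap (@id M) f).
Proof.
move=> fM lf; pose F : {linear U -> V} := HB.pack f (GRing.isLinear.Build _ _ _ _ f lf).
exact: (fM U V F).
Qed.

Lemma flat_injr M U V (f : U -> V) : flat M -> linear f -> injective f ->
  injective (tmap f (@id M)).
Proof.
move=> fM lf fI z z'; rewrite !(tmap_swap _ lf (@linear_id _ M)).
by move/(can_inj (@tswapK _ _ _))/(flat_injl fM lf fI)/(can_inj (@tswapK _ _ _)).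
Qed.

Section Cokernel.
Context (M U W : lmodType K) (i : W -> U) (li : linear i).

(** The tensor product with a quotient. With the scalars enlarged by a set that
    acts trivially on M and by translations through [i] on U, the balancing
    relation identifies [m (x) (u + i w)] with [m (x) u]; so the resulting
    tensor is M (x) (U / i W), without forming that quotient. *)
Let act_r (m : M) (a : K + W) : M := if a is inl k then k *: m else m.
Let act_l (a : K + W) (u : U) : U :=
  match a with inl k => k *: u | inr w => u + i w end.
Let pik (s : seq (M * U)) : M \ox U := \sum_(p <- s) p.1 \ot p.2.

Let img (z : M \ox U) := exists y, tmap id i y = z.

Let tens_rel_img s s' : tens_rel act_r act_l s s' -> img (pik s - pik s').
Proof.
have lt : linear (tmap (@id M) i) by apply: tmap_linear.
have img0 : img 0 by exists 0; apply: linear0_fun.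
have imgD z z' : img z -> img z' -> img (z + z').
  by move=> [y <-] [y' <-]; exists (y + y'); rewrite (linear_eqs lt).1.
have imgN z : img z -> img (- z).
  by move=> [y <-]; exists (- y); rewrite -scaleN1r (linear_eqs lt).2 scaleN1r.
rewrite /pik; elim=> {s s'}
  [s|s s' _ H|s s' s'' _ H _ H'|s1 s1' s2 s2' _ H _ H'|s1 s2|u|m m' u|m u u'|m a u].
- by rewrite subrr.
- by rewrite -opprB; apply: imgN.
- by rewrite -[X in X - _](subrK (\sum_(p <- s') p.1 \ot p.2)) -addrA; apply: imgD.
- by rewrite !big_cat /= opprD addrACA; apply: imgD.
- by rewrite !big_cat /= addrC subrr.
- by rewrite big_seq1 big_nil (linear0_fun (tpureK_linl _)) subr0.
- by rewrite !big_cons !big_nil /= (linear_eqs (tpureK_linl _)).1 !addr0 subrr.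
- by rewrite !big_cons !big_nil /= (linear_eqs (tpureK_linr _)).1 !addr0 subrr.
- rewrite !big_seq1 /=; case: a => [k|w] /=.
    by rewrite (linear_eqs (tpureK_linl _)).2 (linear_eqs (tpureK_linr _)).2 subrr.
  rewrite (linear_eqs (tpureK_linr _)).1 opprD addNKr; apply: imgN.
  by exists (m \ot w); rewrite tmap_pure.
Qed.

(** With [sec] a set-theoretic section of p, m (x) v |-> m (x) sec v is a
    well-defined map to the tensor with the cokernel of [i], and it sends
    [tmap id p z] to the class of z. *)
Lemma tensor_right_exact V (p : U -> V) : linear p ->
    (forall v, exists u, p u = v) -> (forall u, p u = 0 -> exists w, i w = u) ->
  forall z : M \ox U, tmap id p z = 0 -> exists y, tmap id i y = z.
Proof.
move=> lp psurj pker z pz0.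
pose sec v : U := projT1 (cid (psurj v)).
have secK v : p (sec v) = v by rewrite /sec; case: cid.
pose h (m : M) (v : V) : tensor act_r act_l := tpure _ _ m (sec v).
(* Two lifts of v differ by some [i w], which acts trivially on M. *)
have hE m u v : p u = v -> tpure act_r act_l m u = h m v.
  move=> puv; have [w ew] : exists w, i w = sec v - u.
    apply: pker; rewrite (linear_eqs lp).1 -scaleN1r (linear_eqs lp).2.
    by rewrite secK puv scaleN1r subrr.
  have -> : h m v = tpure act_r act_l m (act_l (inr w) u).
    by rewrite /h /= ew addrC subrK.
  by rewrite -tpure_bal.
have bh : balanced (fun (m : M) (k : K) => k *: m) (fun k v => k *: v) h.
  split=> [m m' v|m v v'|m k v]; first exact: tpureDl.
    by rewrite -(hE m (sec v + sec v')) ?(linear_eqs lp).1 ?secK // tpureDr.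
  rewrite -(hE m (k *: sec v)) ?(linear_eqs lp).2 ?secK //.
  exact: (tpure_bal act_r act_l m (inl k)).
have : tsum h (tmap id p z) = 0 by rewrite pz0; apply: tsum0.
have hs s : tsum h (\sum_(q <- s) q.1 \ot p q.2) = \pi_(tensor act_r act_l)%qT s.
  elim: s => [|[m u] s IH]; first by rewrite big_nil tsum0.
  rewrite big_cons tsumD // IH -cat1s pi_cat; congr (_ + _).
  by rewrite (tsum_pure bh) -(hE m u).
rewrite hs -[0]/(\pi_(tensor act_r act_l)%qT [::]) => /tens_rel_pi/tens_rel_img.
by rewrite /pik big_nil subr0 -[X in img X]tensE.
Qed.
End Cokernel.
End Flatness.

Section Exactness.
Context (K : comPzRingType).
Implicit Types U V W P Q M : lmodType K.

(** The image of f as a module of its own, so that f factors as a surjection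
    followed by an injection; flatness concerns the latter. *)
Section Image.
Context (U V : lmodType K) (f : {linear U -> V}).

Definition lin_im_pred : pred V := fun v => `[< exists u, f u = v >].
Record lin_im := LinIm { lin_im_val : V; _ : lin_im_pred lin_im_val }.
HB.instance Definition _ := [isSub for lin_im_val].
HB.instance Definition _ := [Choice of lin_im by <:].

Fact lin_im_closed : subsemimod_closed lin_im_pred.
Proof.
split=> [|a v /asboolP [u <-]]; last first.
  by apply/asboolP; exists (a *: u); rewrite linearZ.
split=> [|v v' /asboolP [u <-] /asboolP [u' <-]]; apply/asboolP.
  by exists 0; apply: linear0.
by exists (u + u'); rewrite linearD.
Qed.
HB.instance Definition _ :=
  GRing.SubChoice_isSubLmodule.Build K V lin_im_pred lin_im lin_im_closed.

Definition to_lin_im (u : U) : lin_im := LinIm (asboolT (ex_intro _ u erefl)).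

Lemma lin_im_val_linear : linear lin_im_val. Proof. by []. Qed.
Lemma to_lin_im_linear : linear to_lin_im.
Proof. by move=> a x y; apply: val_inj; apply: linearP. Qed.
Lemma to_lin_im_surj v : exists u, to_lin_im u = v.
Proof.
by case: v => v vP; have /asboolP [u e] := vP; exists u; apply: val_inj.
Qed.
End Image.

(** The image of f embeds in V and this embedding stays injective after
    tensoring with M; the surjection onto the image is covered by right
    exactness. *)
Lemma flat_kernel M U V W (f : U -> V) (i : W -> U) :
    flat M -> linear f -> linear i -> (forall u, f u = 0 -> exists w, i w = u) ->
  forall z : M \ox U, tmap id f z = 0 -> exists y, tmap id i y = z.
Proof.
move=> fM lf li ker z fz0.
pose F : {linear U -> V} := HB.pack f (GRing.isLinear.Build _ _ _ _ f lf).
have lv := @lin_im_val_linear _ _ F; have lp := @to_lin_im_linear _ _ F.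
apply: (tensor_right_exact li lp (@to_lin_im_surj _ _ F)).
  by move=> u /(congr1 (@lin_im_val _ _ F)); apply: ker.
apply: (flat_injl fM lv val_inj); rewrite tmap_comp //.
by rewrite (linear0_fun (tmap_linear _ lv)) //; exact: fz0.
Qed.

Lemma flat_kernelr M U V W (f : U -> V) (i : W -> U) :
    flat M -> linear f -> linear i -> (forall u, f u = 0 -> exists w, i w = u) ->
  forall z : U \ox M, tmap f id z = 0 -> exists y, tmap i id y = z.
Proof.
move=> fM lf li ker z; rewrite tmap_swap // => fz0.
have [|y yz] := flat_kernel fM lf li ker (z := tswap z).
  by rewrite -[LHS]tswapK fz0; apply: (linear0_fun (@tswap_linear _ _ _)).
by exists (tswap y); rewrite tmap_swap // tswapK yz tswapK.
Qed.

(** An equalizer is the kernel of a difference. *)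
Lemma flat_equalizer M U V W (f h : U -> V) (i : W -> U) :
    flat M -> linear f -> linear h -> linear i ->
    (forall u, f u = h u -> exists w, i w = u) ->
  forall z : M \ox U, tmap id f z = tmap id h z -> exists y, tmap id i y = z.
Proof.
move=> fM lf lh li eqi z e.
have lfh : linear (fun u => -1 *: h u + f u) by lin.
apply: (flat_kernel fM lfh li) => [u e0|].
  by apply: eqi; apply/eqP; rewrite -subr_eq0 addrC -scaleN1r e0.
by rewrite tmapPr e scaleN1r addNr.
Qed.

Lemma flat_equalizerr M U V W (f h : U -> V) (i : W -> U) :
    flat M -> linear f -> linear h -> linear i ->
    (forall u, f u = h u -> exists w, i w = u) ->
  forall z : U \ox M, tmap f id z = tmap h id z -> exists y, tmap i id y = z.
Proof.
move=> fM lf lh li eqi z e.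
have lfh : linear (fun u => -1 *: h u + f u) by lin.
apply: (flat_kernelr fM lfh li) => [u e0|].
  by apply: eqi; apply/eqP; rewrite -subr_eq0 addrC -scaleN1r e0.
by rewrite tmapPl e scaleN1r addNr.
Qed.
End Exactness.

Section FieldCase.
Context (K : comPzRingType) (hK : is_field K).

(** Over a field an injective linear map has a linear retraction: a subspace
    that is maximal among those meeting the image trivially is a complement
    of the image. *)
Lemma field_retraction (U V : lmodType K) (f : U -> V) :
  linear f -> injective f -> exists2 r : V -> U, linear r & cancel f r.
Proof.
move=> lf fI; have [K1 Kinv] := hK.
pose good (W : set V) := (forall a x y, W x -> W y -> W (a *: x + y)) /\
  (forall u, W (f u) -> f u = 0).
(* The empty chain is harmless: [good] is closed under combinations of its
   elements but need not contain 0. *)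
have [] := @Zorn_bigcup V good.
  move=> F Fgood Ftot; split=> [a x y [A FA Ax] [B FB By]|u [A FA Au]]; last first.
    exact: (Fgood A FA).2.
  have [AB|BA] := Ftot A B FA FB.
    by exists B => //; apply: (Fgood B FB).1 => //; apply: AB.
  by exists A => //; apply: (Fgood A FA).1 => //; apply: BA.
move=> W [[Wlin Wtriv] Wmax].
have W0 : W 0.
  apply: contrapT => nW0; apply: (Wmax [set 0]%classic); last first.
    split=> [a x y -> ->|u //]; first by rewrite /= scaler0 addr0.
  have We x : ~ W x.
    move=> Wx; apply: nW0; have := Wlin (-1) x x Wx Wx.
    by rewrite scaleN1r addNr.
  by split=> [x /We //|/(_ 0 erefl)].
have WD x y : W x -> W y -> W (x + y).
  by move=> Wx Wy; rewrite -[x]scale1r; apply: Wlin.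
have WZ a x : W x -> W (a *: x).
  by move=> Wx; rewrite -[_ *: _]addr0; apply: Wlin.
have Wdec v : exists u, W (v - f u).
  apply: contrapT => nv.
  (* Otherwise v could be adjoined to W. *)
  pose W' : set V := [set x | exists k, W (x - k *: v)]%classic.
  apply: (Wmax W'); last first.
    split=> [a x y [k Wx] [l Wy]|u [k Wu]].
      exists (a * k + l); rewrite scalerDl -scalerA opprD addrACA -scalerBr.
      exact: Wlin.
    have [k0|k0] := eqVneq k 0; first by move: Wu; rewrite k0 scale0r subr0 => /Wtriv.
    have [k' kk'] := Kinv k k0; case: nv; exists (k' *: u).
    have := WZ (- k') _ Wu; rewrite scaleNr scalerBr scalerA mulrC kk' scale1r opprB.
    by rewrite (linear_eqs lf).2.
  split=> [x Wx|sub]; first by exists 0; rewrite scale0r subr0.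
  case: nv; exists 0; rewrite (linear0_fun lf) subr0; apply: sub.
  by exists 1; rewrite scale1r subrr.
pose r v := projT1 (cid (Wdec v)).
have rP v : W (v - f (r v)) by rewrite /r; case: cid.
have runiq v u : W (v - f u) -> r v = u.
  move=> Wu; apply: fI; apply/eqP; rewrite -subr_eq0; apply/eqP.
  have e : f (r v) - f u = f (r v - u).
    by rewrite (linear_eqs lf).1 -(scaleN1r u) (linear_eqs lf).2 scaleN1r.
  rewrite e; apply: Wtriv; rewrite -e.
  have := WD _ _ Wu (WZ (-1) _ (rP v)).
  by rewrite scaleN1r opprB addrC addrA subrK.
exists r => [a x y|u]; apply: runiq; last by rewrite subrr.
by rewrite lf opprD addrACA -scalerBr; apply: Wlin; apply: rP.
Qed.

Lemma field_flat (M : lmodType K) : flat M.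
Proof.
move=> U V f fI; have lf : linear f by apply: linearP.
have [r lr fK] := field_retraction lf fI.
apply: (can_inj (g := tmap id r)) => z.
rewrite tmap_comp //.
by rewrite -[RHS]tmap_id; apply: eq_lsum => m u /=; rewrite fK.
Qed.

Lemma field_dual_separates (M : lmodType K) : dual_separates M.
Proof.
move=> x fx0; have [K1 Kinv] := hK; apply: contrapT => x0.
have lx : linear (fun a : K^o => (a : K) *: x) by lin.
have [|r lr rK] := field_retraction lx.
  move=> a b /= ab; apply/eqP; rewrite -subr_eq0; apply/eqP.
  apply: contrapT => /eqP /Kinv [c abc]; apply: x0.
  by rewrite -[x]scale1r -abc mulrC -scalerA scalerBl ab subrr scaler0.
case/eqP: K1; rewrite -(rK 1) scale1r; exact: (fx0 (mkklin lr)).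
Qed.
End FieldCase.

(** * Sweedler calculus and the cotensor product *)

Section Sweedler.
Context (K : comPzRingType) (C : coalgType K).
Implicit Types P : lmodType K.

Lemma lsum_comulA P (F : C -> C -> C -> P) c :
  (forall v w, linear (fun u => F u v w)) -> (forall u w, linear (fun v => F u v w)) ->
  (forall u v, linear (fun w => F u v w)) ->
  \lsum_(x, w <- \Delta c) \lsum_(u, v <- \Delta x) F u v w =
  \lsum_(u, x <- \Delta c) \lsum_(v, w <- \Delta x) F u v w.
Proof.
move=> F1 F2 F3.
have := congr1 (fun z => \lsum_(u, x <- z) \lsum_(v, w <- x) F u v w) (comulA c).
rewrite lsum_tassoc ?lsum_tmap; [|lin..] => e.
refine (eq_trans _ (eq_trans e _)); last by [].
by apply: eq_lsum => x w; apply: eq_lsum => u v; rewrite lsum_pure //; lin.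
Qed.

Lemma lsum_counitl P (f : C -> P) c : linear f ->
  \lsum_(u, v <- \Delta c) ((\eps u : K) *: f v) = f c.
Proof.
move=> lf; rewrite -[in RHS](counitl c) (linear_lsum _ _ lf).
by apply: eq_lsum => u v; rewrite (linear_eqs lf).2.
Qed.

Lemma lsum_counitr P (f : C -> P) c : linear f ->
  \lsum_(u, v <- \Delta c) ((\eps v : K) *: f u) = f c.
Proof.
move=> lf; rewrite -[in RHS](counitr c) (linear_lsum _ _ lf).
by apply: eq_lsum => u v; rewrite (linear_eqs lf).2.
Qed.
End Sweedler.

Section Cotensor.
Context (K : comPzRingType) (C D : coalgType K) (g : {linear C -> D}).
Implicit Types (P : lmodType K) (a b : bicEnd g) (x : cot g) (c : C).

Lemma bicEnd_linear a : linear a.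
Proof. exact: klin_linear. Qed.

Lemma bicEnd_hom a : @bicomod_hom K D D (bicomod_DCD g) (bicomod_DCD g) a.
Proof. by apply/asboolP; exact: (valP a). Qed.

Lemma cot_val_linear : linear (@cot_val K C D g). Proof. by []. Qed.

(** Colinearity of [a] for the left D-coaction, in the form in which it is used:
    under any bilinear map. *)
Lemma lsum_bicEndl a P (B : D -> C -> P) c :
  (forall v, linear (B^~ v)) -> (forall u, linear (B u)) ->
  \lsum_(u, v <- \Delta (a c)) B (g u) v = \lsum_(u, v <- \Delta c) B (g u) (a v).
Proof.
move=> Bl Br; have la := bicEnd_linear a.
have e : tmap g id (\Delta (a c)) = tmap id a (tmap g id (\Delta c)).
  exact: (bicomod_hom_l (bicEnd_hom a) c).
by have := congr1 (lsum B) e; rewrite !lsum_tmap //; lin.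
Qed.

Lemma lsum_bicEndr a P (B : C -> D -> P) c :
  (forall v, linear (B^~ v)) -> (forall u, linear (B u)) ->
  \lsum_(u, v <- \Delta (a c)) B u (g v) = \lsum_(u, v <- \Delta c) B (a u) (g v).
Proof.
move=> Bl Br; have la := bicEnd_linear a.
have e : tmap id g (\Delta (a c)) = tmap a id (tmap id g (\Delta c)).
  exact: (bicomod_hom_r (bicEnd_hom a) c).
by have := congr1 (lsum B) e; rewrite !lsum_tmap //; lin.
Qed.

(** Elements of E are built from maps given by a formula; the sigma type keeps the
    formula as the only thing known about the endomorphism. *)
Lemma exists_bicEnd (f : C -> C) : linear f ->
  (forall c, \lsum_(u, v <- \Delta (f c)) (g u \ot v) =
     \lsum_(u, v <- \Delta c) (g u \ot f v)) ->
  (forall c, \lsum_(u, v <- \Delta (f c)) (u \ot g v) =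
     \lsum_(u, v <- \Delta c) (f u \ot g v)) ->
  {a : bicEnd g | forall c, a c = f c}.
Proof.
move=> lf fl fr.
have h : bicEnd_pred g (mkklin lf).
  apply/asboolP; split=> [|c|c] //=.
    by rewrite /glcoact tmap_comp //; exact: fl.
  by rewrite /grcoact tmap_comp //; exact: fr.
by exists (BicEnd h).
Qed.

Lemma bicEndP a b : (forall c, a c = b c) -> a = b.
Proof. by move=> e; apply: val_inj; apply: endoP. Qed.

Lemma dualCentP (r s : dualCent g) : (forall c, r c = s c) -> r = s.
Proof. by move=> e; apply: val_inj; apply: dualP. Qed.

Lemma lsum_cot x P (F : C -> D -> C -> P) :
  (forall v w, linear (fun u => F u v w)) -> (forall u w, linear (fun v => F u v w)) ->
  (forall u v, linear (fun w => F u v w)) ->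
  \lsum_(u, v <- cot_val x) \lsum_(u1, u2 <- \Delta u) F u1 (g u2) v =
  \lsum_(u, v <- cot_val x) \lsum_(v1, v2 <- \Delta v) F u (g v1) v2.
Proof.
move=> F1 F2 F3.
have xP : tassoc (tmap (grcoact g) id (cot_val x)) = tmap id (glcoact g) (cot_val x).
  by apply/eqP; exact: (valP x).
move: xP => /(congr1 (fun z => \lsum_(u, y <- z) \lsum_(d, w <- y) F u d w)).
have lr := grcoact_linear g; have ll := glcoact_linear g.
rewrite lsum_tassoc ?lsum_tmap; [|lin..] => e.
refine (eq_trans _ (eq_trans e _)).
  apply: eq_lsum => u v; rewrite lsum_tmap; lin.
  by apply: eq_lsum => u1 u2; rewrite lsum_pure //; lin.
by apply: eq_lsum => u v; rewrite lsum_tmap; lin.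
Qed.

(** Right D-colinearity of [a] and coassociativity put a(c1) (x) c2 in the
    cotensor product. *)
Lemma cot_comul_subproof a c : cot_pred g (tmap a id (\Delta c)).
Proof.
apply/eqP; have la := bicEnd_linear a.
have lr := grcoact_linear g; have ll := glcoact_linear g.
rewrite !tmap_comp // tassocE tmapE lsum_tmap; lin.
transitivity (\lsum_(x, w <- \Delta c) \lsum_(u, v <- \Delta x) (a u \ot (g v \ot w))).
  apply: eq_lsum => x w.
  by rewrite /= /grcoact lsum_tmap ?(lsum_bicEndr _ (B := fun u v => u \ot (v \ot w))); lin.
rewrite lsum_comulA; lin.
apply: eq_lsum => u x /=; rewrite /glcoact tmapE linear_lsum //; lin.
Qed.

Definition cot_comul a c : cot g := Cot (cot_comul_subproof a c).

Lemma cot_comul_linear a : linear (cot_comul a).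
Proof.
have la := bicEnd_linear a.
by move=> k x y; apply: val_inj; rewrite /= comul_linear; apply: (tmap_linear la).
Qed.
End Cotensor.

(** * Coactions on the cotensor product *)

Section Coactions.
Context (K : comPzRingType) (C D : coalgType K) (g : {linear C -> D}).
Context (fC : flat C).
Implicit Types (P : lmodType K) (x : cot g) (c : C).

Let lv : linear (@cot_val K C D g). Proof. exact: cot_val_linear. Qed.
Let lr := grcoact_linear g.
Let ll := glcoact_linear g.

Let cot_equalizer (u : C \ox C) :
  tassoc (tmap (grcoact g) id u) = tmap id (glcoact g) u ->
  exists w : cot g, cot_val w = u.
Proof.
move=> e; have uP : cot_pred g u by apply/eqP.
by exists (Cot uP).
Qed.

(** The required lift exists: applying the comultiplication to the first tensorand
    of an element of the cotensor product yields an element of the equalizer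
    tensored with C, which flatness identifies with C (x) X. *)
Lemma cot_lcoE x :
  tmap id (@cot_val K C D g) (cot_lco x) = tassoc (tmap \Delta id (cot_val x)).
Proof.
rewrite /cot_lco /cot_lift_r; case: xgetP => [y _ //|no].
have [|||y yE] := flat_equalizer fC _ _ lv cot_equalizer
  (z := tassoc (tmap \Delta id (cot_val x))); [lin|lin| |by case: (no y)].
rewrite ![tmap id _ (tassoc _)]tmapE !lsum_tassoc ?lsum_tmap; lin.
transitivity (\lsum_(u, v <- cot_val x) \lsum_(q, b <- \Delta u)
   \lsum_(c, a <- \Delta q) (c \ot (a \ot (g b \ot v)))).
  apply: eq_lsum => u v; rewrite lsum_comulA; lin.
    apply: eq_lsum => c y; rewrite tmap_pure ?tassocE //; lin.
  rewrite lsum_pure; lin; rewrite /grcoact lsum_tmap ?linear_lsum; [|lin..].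
  by apply: eq_lsum => a b.
rewrite (lsum_cot _
  (F := fun q b v => \lsum_(c, a <- \Delta q) (c \ot (a \ot (b \ot v))))); lin.
apply: eq_lsum => u v; rewrite exchange_lsum; apply: eq_lsum => c a.
rewrite tmap_pure //; lin; rewrite /glcoact tmapE !linear_lsum; lin.
by [].
Qed.

Lemma cot_rcoE x :
  tmap (@cot_val K C D g) id (cot_rco x) = tassocV (tmap id \Delta (cot_val x)).
Proof.
have lV := @tassocV_linear K.
rewrite /cot_rco /cot_lift_l; case: xgetP => [y _ //|no].
have [|||y yE] := flat_equalizerr fC _ _ lv cot_equalizer
  (z := tassocV (tmap id \Delta (cot_val x))); [lin|lin| |by case: (no y)].
rewrite ![tmap _ id (tassocV _)]tmapE !lsum_tassocV ?lsum_tmap; lin.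
transitivity (\lsum_(u, v <- cot_val x) \lsum_(v1, v2 <- \Delta v)
   \lsum_(u1, u2 <- \Delta u) ((u1 \ot (g u2 \ot v1)) \ot v2)).
  apply: eq_lsum => u v; apply: eq_lsum => v1 v2; rewrite tmap_pure ?tassocE //; lin.
  rewrite lsum_pure; lin; rewrite /grcoact lsum_tmap; lin.
  by rewrite (linear_lsum (f := fun z => z \ot v2)); lin.
under eq_lsum => u v do rewrite exchange_lsum.
rewrite (lsum_cot _
  (F := fun u b v => \lsum_(v1, v2 <- \Delta v) ((u \ot (b \ot v1)) \ot v2))); lin.
apply: eq_lsum => u v; rewrite -lsum_comulA; lin; apply: eq_lsum => v1 v2.
rewrite tmap_pure //; lin; rewrite /glcoact (tmapE g) linear_lsum; lin.
by rewrite (linear_lsum (f := fun z => z \ot v2)); lin.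
Qed.

Lemma lsum_cot_lco x P (B : C -> C \ox C -> P) :
  (forall y, linear (B^~ y)) -> (forall c, linear (B c)) ->
  \lsum_(c, w <- cot_lco x) B c (cot_val w) =
  \lsum_(u, v <- cot_val x) \lsum_(u1, u2 <- \Delta u) B u1 (u2 \ot v).
Proof.
move=> Bl Br; have := congr1 (lsum B) (cot_lcoE x).
by rewrite lsum_tassoc ?lsum_tmap; lin.
Qed.

Lemma lsum_cot_rco x P (B : C \ox C -> C -> P) :
  (forall c, linear (B^~ c)) -> (forall y, linear (B y)) ->
  \lsum_(w, c <- cot_rco x) B (cot_val w) c =
  \lsum_(u, v <- cot_val x) \lsum_(v1, v2 <- \Delta v) B (u \ot v1) v2.
Proof.
move=> Bl Br; have := congr1 (lsum B) (cot_rcoE x).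
by rewrite lsum_tassocV ?lsum_tmap; lin.
Qed.

Lemma cot_injl (M : lmodType K) : flat M -> injective (tmap (@id M) (@cot_val K C D g)).
Proof. by move=> fM; apply: (flat_injl fM lv); exact: val_inj. Qed.

Lemma cot_injr (M : lmodType K) : flat M -> injective (tmap (@cot_val K C D g) (@id M)).
Proof. by move=> fM; apply: (flat_injr fM lv); exact: val_inj. Qed.

Lemma cot_lco_linear : linear (@cot_lco K C D g).
Proof.
move=> a x y; apply: (cot_injl fC); rewrite (tmap_linear _ lv) // !cot_lcoE.
have l : linear (fun x : cot g => tassoc (tmap \Delta id (cot_val x))) by lin.
exact: l.
Qed.

Lemma cot_rco_linear : linear (@cot_rco K C D g).
Proof.
have lV := @tassocV_linear K.
move=> a x y; apply: (cot_injr fC); rewrite (tmap_linear lv) // !cot_rcoE.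
have l : linear (fun x : cot g => tassocV (tmap id \Delta (cot_val x))) by lin.
exact: l.
Qed.
Let llc := cot_lco_linear.
Let lrc := cot_rco_linear.

(** Coassociativity of the left coaction, inherited from C since the cotensor
    product embeds in C (x) C and C is flat. *)
Lemma lsum_cot_lcoA x P (F : C -> C -> cot g -> P) :
  (forall v w, linear (fun u => F u v w)) -> (forall u w, linear (fun v => F u v w)) ->
  (forall u v, linear (fun w => F u v w)) ->
  \lsum_(c, w <- cot_lco x) \lsum_(c1, c2 <- \Delta c) F c1 c2 w =
  \lsum_(c, w <- cot_lco x) \lsum_(c', w' <- cot_lco w) F c c' w'.
Proof.
move=> F1 F2 F3.
have e : tassoc (tmap \Delta id (cot_lco x)) = tmap id (@cot_lco K C D g) (cot_lco x).
  apply: (flat_injl fC (tmap_linear (@linear_id K C) lv) (cot_injl fC)).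
  rewrite tmap_comp // ?[tmap _ _ (tassoc _)]tmapE ?lsum_tassoc ?lsum_tmap; lin.
  transitivity (\lsum_(c, w <- cot_lco x) \lsum_(c1, c2 <- \Delta c)
    (c1 \ot (c2 \ot cot_val w))).
    by apply: eq_lsum => c w; apply: eq_lsum => c1 c2; rewrite tmap_pure.
  rewrite (lsum_cot_lco _
    (B := fun c y => \lsum_(c1, c2 <- \Delta c) (c1 \ot (c2 \ot y)))); lin.
  rewrite tmapE; under [in RHS]eq_lsum => c w do rewrite /= cot_lcoE.
  rewrite (lsum_cot_lco _ (B := fun c y => c \ot tassoc (tmap \Delta id y))); lin.
  apply: eq_lsum => u v; rewrite lsum_comulA; lin; apply: eq_lsum => c u'.
  rewrite tmap_pure // ?tassocE ?lsum_pure ?linear_lsum //; lin.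
have := congr1 (fun z => \lsum_(c, y <- z) \lsum_(c', w <- y) F c c' w) e.
rewrite /= lsum_tassoc ?lsum_tmap; [|lin..] => <-.
by apply: eq_lsum => c w; apply: eq_lsum => c1 c2; rewrite lsum_pure; lin.
Qed.

(** The two coactions commute as they concern different tensorands of C (x) C. *)
Lemma lsum_cot_lrcoA x P (F : C -> cot g -> C -> P) :
  (forall v w, linear (fun u => F u v w)) -> (forall u w, linear (fun v => F u v w)) ->
  (forall u v, linear (fun w => F u v w)) ->
  \lsum_(y, c <- cot_rco x) \lsum_(c', w <- cot_lco y) F c' w c =
  \lsum_(c', y <- cot_lco x) \lsum_(w, c <- cot_rco y) F c' w c.
Proof.
move=> F1 F2 F3.
have e : tassoc (tmap (@cot_lco K C D g) id (cot_rco x)) =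
    tmap id (@cot_rco K C D g) (cot_lco x).
  apply: (flat_injl fC (tmap_linear lv (@linear_id K C)) (cot_injr fC)).
  rewrite tmapE lsum_tassoc ?lsum_tmap; lin; rewrite [RHS]tmapE lsum_tmap; lin.
  transitivity (\lsum_(y, c <- cot_rco x) \lsum_(u, v <- cot_val y)
      \lsum_(u1, u2 <- \Delta u) (u1 \ot ((u2 \ot v) \ot c))).
    apply: eq_lsum => y c; under eq_lsum => c' w do rewrite tmap_pure //.
    by rewrite (lsum_cot_lco _ (B := fun c' z => c' \ot (z \ot c))); lin.
  rewrite (lsum_cot_rco _ (B := fun y c => \lsum_(u, v <- y)
      \lsum_(u1, u2 <- \Delta u) (u1 \ot ((u2 \ot v) \ot c)))); lin.
  transitivity (\lsum_(c', y <- cot_lco x) \lsum_(u, v <- cot_val y)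
      \lsum_(v1, v2 <- \Delta v) (c' \ot ((u \ot v1) \ot v2))); last first.
    apply: eq_lsum => c' y; rewrite tmapE linear_lsum; lin.
    by rewrite (lsum_cot_rco _ (B := fun y c => c' \ot (y \ot c))); lin.
  rewrite (lsum_cot_lco _ (B := fun c' y => \lsum_(u, v <- y)
      \lsum_(v1, v2 <- \Delta v) (c' \ot ((u \ot v1) \ot v2)))); lin.
  apply: eq_lsum => u v.
  transitivity (\lsum_(v1, v2 <- \Delta v) \lsum_(u1, u2 <- \Delta u)
      (u1 \ot ((u2 \ot v1) \ot v2))).
    by apply: eq_lsum => v1 v2; rewrite lsum_pure; lin.
  by rewrite exchange_lsum; apply: eq_lsum => u1 u2; rewrite lsum_pure; lin.
have := congr1 (fun z => \lsum_(c', y <- z) \lsum_(w, c <- y) F c' w c) e.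
rewrite /= lsum_tassoc ?lsum_tmap; [|lin..] => <-.
by apply: eq_lsum => c w; apply: eq_lsum => c1 c2; rewrite lsum_pure; lin.
Qed.

End Coactions.

(** * Functionals on the cotensor product *)

Section Quasi.
Context (K : comPzRingType) (C D : coalgType K) (g : {linear C -> D}).
Context (fC : flat C) (fD : flat D) (sD : dual_separates D).
Implicit Types (P : lmodType K) (a b : bicEnd g) (x : cot g) (c : C) (r : dualCent g).
Implicit Types (eta : klin (cot g) K^o).

Let lv : linear (@cot_val K C D g). Proof. exact: cot_val_linear. Qed.
Let llc := @cot_lco_linear K C D g fC.
Let lrc := @cot_rco_linear K C D g fC.
Let lbic := @bicEnd_linear K C D g.
Let ldc := @cot_comul_linear K C D g.

Lemma dual_separates_eq (u v : D) : (forall d : codual D, d u = d v) -> u = v.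
Proof.
move=> e; apply/eqP; rewrite -subr_eq0; apply/eqP; apply: sD => f.
by rewrite linearB /= e subrr.
Qed.

Lemma lsum_cot_comul a c P (B : C -> C -> P) :
  (forall v, linear (B^~ v)) -> (forall u, linear (B u)) ->
  \lsum_(u, v <- cot_val (cot_comul a c)) B u v = \lsum_(u, v <- \Delta c) B (a u) v.
Proof. by move=> Bl Br; rewrite lsum_tmap. Qed.

Lemma cot_rco_comul a c : cot_rco (cot_comul a c) = tmap (cot_comul a) id (\Delta c).
Proof.
have lV := @tassocV_linear K.
apply: (cot_injr fC); rewrite (cot_rcoE fC) [RHS]tmap_comp //.
rewrite tassocVE lsum_tmap; lin; rewrite lsum_cot_comul; lin.
rewrite -(lsum_comulA (F := fun u v w => (a u \ot v) \ot w)); lin.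
by apply: eq_lsum => x w; rewrite /= tmapE (linear_lsum (f := fun z => z \ot w)); lin.
Qed.

(** The left D-colinearity of [a] lets [cot_comul a] commute with the coaction only
    once the first tensorand has been mapped to D. *)
Lemma cot_lco_comul a c :
  tmap g id (cot_lco (cot_comul a c)) = tmap g (cot_comul a) (\Delta c).
Proof.
apply: (cot_injl fD); rewrite [LHS]tmap_comp // [RHS]tmap_comp // tmapE.
rewrite (lsum_cot_lco fC _ (B := fun c y => g c \ot y)); lin.
rewrite (lsum_cot_comul _ _
  (B := fun u v => \lsum_(u1, u2 <- \Delta u) (g u1 \ot (u2 \ot v)))); lin.
under eq_lsum => u v.
  rewrite (lsum_bicEndl _ (B := fun d e => d \ot (e \ot v))); lin.
  over.
rewrite lsum_comulA; lin.
by apply: eq_lsum => u y; rewrite /= tmapE linear_lsum; lin.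
Qed.

Lemma exists_dualCent (f : C -> K^o) : linear f ->
  (forall (d : codual D) c, \lsum_(u, v <- \Delta c) ((f u : K) *: d (g v)) =
     \lsum_(u, v <- \Delta c) ((d (g u) : K) *: f v)) ->
  {r : dualCent g | forall c, r c = f c}.
Proof.
move=> lf fc.
have h : dualCent_pred g (mkklin lf).
  by apply/asboolP => d; apply: dualP => c; apply: (fc d c).
by exists (DualCent h).
Qed.

Lemma dualCent_linear r : linear r.
Proof. exact: klin_linear. Qed.

(** The centralizer condition for r, freed from functionals on D. *)
Lemma dualCent_comm r c :
  \lsum_(u, v <- \Delta c) ((r u : K) *: g v) =
  \lsum_(u, v <- \Delta c) ((r v : K) *: g u).
Proof.
have rP : forall d, dualCent_val r * gdual g d = gdual g d * dualCent_val r.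
  by apply/asboolP; exact: (valP r).
apply: dual_separates_eq => d; rewrite !(linear_lsum (f := d)); lin.
refine (eq_trans _ (eq_trans (congr1 (fun f : codual C => f c) (rP d)) _)).
  by apply: eq_lsum => u v; rewrite linearZ.
by apply: eq_lsum => u v; rewrite linearZ; apply: (@mulrC K).
Qed.

(** The same for a D^*-central functional on the cotensor product. *)
Lemma dual_cent_comm eta x : cot_dual_cent eta ->
  \lsum_(c, w <- cot_lco x) ((eta w : K) *: g c) =
  \lsum_(w, c <- cot_rco x) ((eta w : K) *: g c).
Proof.
move=> etaP; apply: dual_separates_eq => d; rewrite !(linear_lsum (f := d)); lin.
refine (eq_trans _ (eq_trans (etaP d x) _)).
  by apply: eq_lsum => u v; rewrite linearZ; apply: (@mulrC K).
by apply: eq_lsum => u v; rewrite linearZ.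
Qed.

(** The two sides of the centralizer condition are those of the centrality of eta
    at the element a(c1) (x) c2. *)
Lemma exists_dual_coord eta a : cot_dual_cent eta ->
  {r : dualCent g | forall c, r c = eta (cot_comul a c)}.
Proof.
move=> etaP; apply: exists_dualCent => [|d c]; first by lin.
have e : \lsum_(u, w <- cot_lco (cot_comul a c)) ((d (g u) : K) *: eta w) =
    \lsum_(w, u <- cot_rco (cot_comul a c)) ((eta w : K) *: d (g u)) := etaP d _.
rewrite cot_rco_comul lsum_tmap in e; [|lin..]; rewrite -e.
have := congr1 (lsum (fun u w => (d u : K) *: eta w)) (cot_lco_comul a c).
by rewrite !lsum_tmap; lin.
Qed.

Definition dual_coord eta (etaP : cot_dual_cent eta) a : dualCent g :=
  sval (exists_dual_coord a etaP).

Lemma dual_coordE eta (etaP : cot_dual_cent eta) a c :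
  dual_coord etaP a c = eta (cot_comul a c).
Proof. by rewrite /dual_coord; case: (exists_dual_coord a etaP). Qed.

(** The map C (x) eta on the left coaction: c (x) c' |-> c1 eta(c2 (x) c'). *)
Definition contract eta x : C := \lsum_(c, w <- cot_lco x) ((eta w : K) *: c).

Lemma contract_linear eta : linear (contract eta).
Proof. by rewrite /contract; lin. Qed.

(** [contract eta] is left C-colinear, by coassociativity of the left coaction. *)
Lemma lsum_contract eta x P (B : C -> C -> P) :
  (forall v, linear (B^~ v)) -> (forall u, linear (B u)) ->
  \lsum_(u, v <- \Delta (contract eta x)) B u v =
  \lsum_(c, w <- cot_lco x) B c (contract eta w).
Proof.
move=> Bl Br; have lc := contract_linear eta.
have lB : linear (lsum B) by lin.
rewrite -[LHS]/(lsum B (\Delta (contract eta x))) /contract.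
rewrite (linear_lsum (f := fun z => lsum B (\Delta z))); lin.
transitivity (\lsum_(c, w <- cot_lco x) \lsum_(u, v <- \Delta c) ((eta w : K) *: B u v)).
  apply: eq_lsum => c w.
  by rewrite (linear_eqs (@comul_linear _ _)).2 (linear_eqs lB).2 /lsum lsumZ.
rewrite (lsum_cot_lcoA fC _ (F := fun u v w => (eta w : K) *: B u v)); lin.
apply: eq_lsum => c w; rewrite (linear_lsum (f := B c)); lin.
by apply: eq_lsum => u v; rewrite (linear_eqs (Br c)).2.
Qed.

(** Left D-colinearity comes from that of [a] and of [contract eta]. On the right,
    centrality of eta moves the D-leg past eta, and then the two coactions on the
    cotensor product commute. *)
Lemma exists_contract_comul eta a : cot_dual_cent eta ->
  {b : bicEnd g | forall c, b c = contract eta (cot_comul a c)}.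
Proof.
move=> etaP; have lc := contract_linear eta; apply: exists_bicEnd => [|c|c]; first by lin.
  rewrite lsum_contract; lin.
  have := congr1 (lsum (fun u w => u \ot contract eta w)) (cot_lco_comul a c).
  by rewrite !lsum_tmap; lin.
rewrite lsum_contract; lin.
transitivity (\lsum_(c', y <- cot_lco (cot_comul a c)) \lsum_(w, u <- cot_rco y)
    (c' \ot ((eta w : K) *: g u))).
  apply: eq_lsum => c' y; rewrite /contract (linear_lsum (f := fun z => c' \ot g z)); lin.
  rewrite -[RHS](linear_lsum (f := fun z => c' \ot z)); lin.
  rewrite -dual_cent_comm // (linear_lsum (f := fun z => c' \ot z)); lin.
  by apply: eq_lsum => u w; rewrite linearZ.
rewrite -(lsum_cot_lrcoA fC _ (F := fun c' w u => c' \ot ((eta w : K) *: g u))); lin.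
rewrite cot_rco_comul lsum_tmap; lin.
apply: eq_lsum => u v /=; rewrite /contract (linear_lsum (f := fun z => z \ot g v)); lin.
apply: eq_lsum => u' w; rewrite (linear_eqs (tpureK_linr _)).2.
by rewrite (linear_eqs (tpureK_linl _)).2.
Qed.

Definition contract_bicEnd eta (etaP : cot_dual_cent eta) a : bicEnd g :=
  sval (exists_contract_comul a etaP).

Lemma contract_bicEndE eta (etaP : cot_dual_cent eta) a c :
  contract_bicEnd etaP a c = contract eta (cot_comul a c).
Proof. by rewrite /contract_bicEnd; case: (exists_contract_comul a etaP). Qed.
End Quasi.

(** * Source, target and counit *)

Section SourceTarget.
Context (K : comPzRingType) (C D : coalgType K) (g : {linear C -> D}).
Context (sD : dual_separates D).
Implicit Types (P : lmodType K) (a b : bicEnd g) (c : C) (r : dualCent g).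

Let lbic := @bicEnd_linear K C D g.
Let ldual := @dualCent_linear K C D g.

Definition source_fun r c : C := \lsum_(u, v <- \Delta c) ((r v : K) *: u).
Definition target_fun r c : C := \lsum_(u, v <- \Delta c) ((r u : K) *: v).

Let lsource r : linear (source_fun r). Proof. by rewrite /source_fun; lin. Qed.
Let ltarget r : linear (target_fun r). Proof. by rewrite /target_fun; lin. Qed.

Lemma lsum_source_fun r c P (B : C -> C -> P) :
  (forall v, linear (B^~ v)) -> (forall u, linear (B u)) ->
  \lsum_(u, v <- \Delta (source_fun r c)) B u v =
  \lsum_(u, v <- \Delta c) B u (source_fun r v).
Proof.
move=> Bl Br; rewrite /source_fun (linear_lsum (f := fun z => lsum B (\Delta z))); lin.
transitivity (\lsum_(x, w <- \Delta c) \lsum_(u, v <- \Delta x) ((r w : K) *: B u v)).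
  apply: eq_lsum => x w; rewrite -lsumZ -(linear_eqs (tsumK_linear Bl Br)).2.
  by rewrite (linear_eqs (@comul_linear _ _)).2.
rewrite lsum_comulA; lin; apply: eq_lsum => u x; rewrite (linear_lsum (f := B u)); lin.
by apply: eq_lsum => v w; rewrite (linear_eqs (Br u)).2.
Qed.

Lemma lsum_target_fun r c P (B : C -> C -> P) :
  (forall v, linear (B^~ v)) -> (forall u, linear (B u)) ->
  \lsum_(u, v <- \Delta (target_fun r c)) B u v =
  \lsum_(u, v <- \Delta c) B (target_fun r u) v.
Proof.
move=> Bl Br; rewrite /target_fun (linear_lsum (f := fun z => lsum B (\Delta z))); lin.
transitivity (\lsum_(w, x <- \Delta c) \lsum_(u, v <- \Delta x) ((r w : K) *: B u v)).
  apply: eq_lsum => x w; rewrite -lsumZ -(linear_eqs (tsumK_linear Bl Br)).2.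
  by rewrite (linear_eqs (@comul_linear _ _)).2.
rewrite -lsum_comulA; lin; apply: eq_lsum => x v; rewrite (linear_lsum (f := B^~ v)); lin.
by apply: eq_lsum => w u; rewrite (linear_eqs (Bl v)).2.
Qed.

(** Both sides apply r to the middle tensorand of c1 (x) c2 (x) c3. *)
Lemma lsum_source_target r c P (B : C -> C -> P) :
  (forall v, linear (B^~ v)) -> (forall u, linear (B u)) ->
  \lsum_(u, v <- \Delta c) B (source_fun r u) v =
  \lsum_(u, v <- \Delta c) B u (target_fun r v).
Proof.
move=> Bl Br.
transitivity (\lsum_(x, w <- \Delta c) \lsum_(u, v <- \Delta x) ((r v : K) *: B u w)).
  apply: eq_lsum => x w; rewrite (linear_lsum (f := B^~ w)); lin.
  by apply: eq_lsum => u v; rewrite (linear_eqs (Bl w)).2.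
rewrite lsum_comulA; lin.
apply: eq_lsum => u x; rewrite (linear_lsum (f := B u)); lin.
by apply: eq_lsum => v w; rewrite (linear_eqs (Br u)).2.
Qed.

(** This is where r has to centralize D^*: source and target agree over D, so that
    each is also colinear on the side where this is not automatic. *)
Lemma map_source_target r c : g (source_fun r c) = g (target_fun r c).
Proof.
rewrite /source_fun /target_fun !(linear_lsum (f := g)); lin.
refine (eq_trans _ (eq_trans (esym (dualCent_comm sD r c)) _)).
  by apply: eq_lsum => u v; rewrite linearZ.
by apply: eq_lsum => u v; rewrite linearZ.
Qed.

Lemma exists_source r : {a : bicEnd g | forall c, a c = source_fun r c}.
Proof.
apply: exists_bicEnd => [|c|c]; first exact: lsource.
  by rewrite lsum_source_fun; lin.
rewrite lsum_source_fun; lin.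
rewrite (lsum_source_target _ _ (B := fun u v => u \ot g v)); lin.
by apply: eq_lsum => u v; rewrite map_source_target.
Qed.

Lemma exists_target r : {a : bicEnd g | forall c, a c = target_fun r c}.
Proof.
apply: exists_bicEnd => [|c|c]; first exact: ltarget.
  rewrite lsum_target_fun; lin.
  rewrite -(lsum_source_target _ _ (B := fun u v => g u \ot v)); lin.
  by apply: eq_lsum => u v; rewrite map_source_target.
by rewrite lsum_target_fun; lin.
Qed.

Definition source r : bicEnd g := sval (exists_source r).
Definition target r : bicEnd g := sval (exists_target r).

Lemma sourceE r c : source r c = source_fun r c.
Proof. by rewrite /source; case: (exists_source r). Qed.
Lemma targetE r c : target r c = target_fun r c.
Proof. by rewrite /target; case: (exists_target r). Qed.

Lemma lsum_source r c P (B : C -> C -> P) :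
  (forall v, linear (B^~ v)) -> (forall u, linear (B u)) ->
  \lsum_(u, v <- \Delta (source r c)) B u v = \lsum_(u, v <- \Delta c) B u (source r v).
Proof.
by move=> Bl Br; rewrite sourceE lsum_source_fun //; apply: eq_lsum => u v; rewrite sourceE.
Qed.

Lemma lsum_target r c P (B : C -> C -> P) :
  (forall v, linear (B^~ v)) -> (forall u, linear (B u)) ->
  \lsum_(u, v <- \Delta (target r c)) B u v = \lsum_(u, v <- \Delta c) B (target r u) v.
Proof.
by move=> Bl Br; rewrite targetE lsum_target_fun //; apply: eq_lsum => u v; rewrite targetE.
Qed.

(** By left and right D-colinearity of [a], both sides of the centralizer condition
    for a functional d evaluate to d(g(a(c))). *)
Lemma exists_bic_eps a : {r : dualCent g | forall c, r c = \eps (a c)}.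
Proof.
apply: exists_dualCent => [|d c]; first by lin.
rewrite -(lsum_bicEndr _ (B := fun u v => (\eps u : K) *: d v)); lin.
rewrite -(lsum_bicEndl _ (B := fun u v => (d u : K) *: \eps v)); lin.
rewrite (lsum_counitl (f := fun v => d (g v))); lin.
rewrite -(lsum_counitr (f := fun v => d (g v))); lin.
by apply: eq_lsum => u v; apply: (@mulrC K).
Qed.

Definition bic_eps a : dualCent g := sval (exists_bic_eps a).
Lemma bic_epsE a c : bic_eps a c = \eps (a c).
Proof. by rewrite /bic_eps; case: (exists_bic_eps a). Qed.

Lemma dualCent_mulE r r' c : (r * r') c = \lsum_(u, v <- \Delta c) ((r u : K) *: r' v).
Proof. by []. Qed.

Lemma sourceD r r' : source (r + r') = source r + source r'.
Proof.
apply: bicEndP => c; rewrite -[RHS]/(source r c + source r' c) !sourceE.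
by rewrite -[RHS]tsumDf; apply: eq_lsum => u v; rewrite -scalerDl.
Qed.

Lemma targetD r r' : target (r + r') = target r + target r'.
Proof.
apply: bicEndP => c; rewrite -[RHS]/(target r c + target r' c) !targetE.
by rewrite -[RHS]tsumDf; apply: eq_lsum => u v; rewrite -scalerDl.
Qed.

Lemma sourceM r r' : source (r * r') = source r * source r'.
Proof.
apply: bicEndP => c; rewrite -[RHS]/(source r (source r' c)) !sourceE /source_fun.
rewrite (lsum_source_fun _ _ (B := fun u v => (r v : K) *: u)); lin.
apply: eq_lsum => u v; rewrite dualCent_mulE /source_fun (linear_lsum (f := r)); lin.
rewrite !lsum_scalel; apply: eq_lsum => x y.
by rewrite (linear_eqs (ldual r)).2; congr (_ *: u); apply: mulrC.
Qed.

Lemma targetM r r' : target (r * r') = target r' * target r.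
Proof.
apply: bicEndP => c; rewrite -[RHS]/(target r' (target r c)) !targetE /target_fun.
rewrite (lsum_target_fun _ _ (B := fun u v => (r' u : K) *: v)); lin.
apply: eq_lsum => u v; rewrite dualCent_mulE /target_fun (linear_lsum (f := r')); lin.
by rewrite !lsum_scalel; apply: eq_lsum => x y; rewrite (linear_eqs (ldual r')).2.
Qed.

Lemma source_scalar (k : K) : source (inK k) = inK k.
Proof.
apply: bicEndP => c; rewrite sourceE -[RHS]/(k *: c).
rewrite -[in RHS](lsum_counitr c (@linear_id K C)).
by rewrite lsumZ; apply: eq_lsum => u v; rewrite scalerA.
Qed.

Lemma target_scalar (k : K) : target (inK k) = inK k.
Proof.
apply: bicEndP => c; rewrite targetE -[RHS]/(k *: c).
rewrite -[in RHS](lsum_counitl c (@linear_id K C)).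
by rewrite lsumZ; apply: eq_lsum => u v; rewrite scalerA.
Qed.

Lemma source_targetC r r' : source r * target r' = target r' * source r.
Proof.
apply: bicEndP => c.
rewrite -[RHS]/(target r' (source r c)) -[LHS]/(source r (target r' c)).
rewrite [LHS]sourceE [RHS]targetE /source_fun /target_fun.
rewrite (lsum_target _ _ (B := fun u v => (r v : K) *: u)); lin.
rewrite (lsum_source _ _ (B := fun u v => (r' u : K) *: v)); lin.
transitivity (\lsum_(x, w <- \Delta c) \lsum_(u, v <- \Delta x)
    ((r w : K) *: ((r' u : K) *: v))).
  by apply: eq_lsum => x w; rewrite targetE -lsumZ.
rewrite lsum_comulA; lin; apply: eq_lsum => u x; rewrite sourceE /source_fun lsumZ.
by apply: eq_lsum => v w; rewrite !scalerA mulrC.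
Qed.

Lemma source1 : source 1 = 1.
Proof. by apply: bicEndP => c; rewrite sourceE; apply: lsum_counitr (@linear_id K C). Qed.
Lemma target1 : target 1 = 1.
Proof. by apply: bicEndP => c; rewrite targetE; apply: lsum_counitl (@linear_id K C). Qed.

Lemma bactE r a r' c : bact source target r a r' c = a (source r' (target r c)).
Proof. by []. Qed.
End SourceTarget.

(** * Coordinates in the tensor square of E *)

Section AdditiveMaps.

Lemma additive_big_sum (P Q : zmodType) (f : P -> Q) I (r : seq I) (F : I -> P) :
  {morph f : x y / x + y} -> f (\sum_(i <- r) F i) = \sum_(i <- r) f (F i).
Proof.
move=> fD; apply: (big_morph f fD).
by apply: (addrI (f 0)); rewrite -fD !addr0.
Qed.

Context (A : Type) (M N : zmodType) (ra : M -> A -> M) (la : A -> N -> N).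

Lemma additive_tsum (P Q : zmodType) (f : P -> Q) (b : M -> N -> P) (z : tensor ra la) :
  {morph f : x y / x + y} -> f (tsum b z) = tsum (fun m n => f (b m n)) z.
Proof. exact: additive_big_sum. Qed.

Lemma eq_tensor (P : zmodType) (f h : tensor ra la -> P) :
  {morph f : x y / x + y} -> {morph h : x y / x + y} ->
  (forall m n, f (tpure ra la m n) = h (tpure ra la m n)) -> f =1 h.
Proof.
move=> fD hD e z; rewrite [z]tensE (additive_big_sum _ _ fD) (additive_big_sum _ _ hD).
by apply: eq_bigr => p _; apply: e.
Qed.

End AdditiveMaps.

Lemma linear_big_sum (K : comPzRingType) (U V : lmodType K) (f : U -> V)
    I (r : seq I) (F : I -> U) :
  linear f -> f (\sum_(i <- r) F i) = \sum_(i <- r) f (F i).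
Proof. by move=> lf; apply: additive_big_sum; move=> x y; rewrite (linear_eqs lf).1. Qed.

Section Coordinates.
Context (K : comPzRingType) (C D : coalgType K) (g : {linear C -> D}).
Context (fC : flat C) (fD : flat D) (sD : dual_separates D).
Context (N : nat) (alpha : 'I_N -> bicEnd g) (eta : 'I_N -> klin (cot g) K^o).
Context (qb : quasibases alpha eta).
Implicit Types (P : lmodType K) (a b e : bicEnd g) (c : C) (r : dualCent g).

Let lv : linear (@cot_val K C D g). Proof. exact: cot_val_linear. Qed.
Let llc := @cot_lco_linear K C D g fC.
Let lrc := @cot_rco_linear K C D g fC.
Let lbic := @bicEnd_linear K C D g.
Let ldc := @cot_comul_linear K C D g.
Let etaP i : cot_dual_cent (eta i) := quasibases_cent qb i.
Let lct i := @contract_linear K C D g fC (eta i).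

Local Notation s := (@source K C D g sD).
Local Notation t := (@target K C D g sD).
Local Notation EE := (tensR s t).
Local Notation "x \oR y" := (tpureR s t x y) (at level 40).

(** The elements of R that are the coordinates of [a] in the [alpha i]. *)
Definition rcoord i a : dualCent g := dual_coord fC fD (etaP i) a.
(** The first tensorands of the comultiplication of [a], that is the maps
    c |-> a(c1)_(1) eta_i(a(c1)_(2) (x) c2). *)
Definition Delta_coord i a : bicEnd g := contract_bicEnd fC fD sD (etaP i) a.

Lemma rcoordE i a c : rcoord i a c = eta i (cot_comul a c).
Proof. exact: dual_coordE. Qed.

Lemma Delta_coordE i a c : Delta_coord i a c = contract (eta i) (cot_comul a c).
Proof. exact: contract_bicEndE. Qed.

(** The quasibase equation with the counit applied to the last tensorand. *)
Lemma quasi_val (x : cot g) :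
  \lsum_(u, v <- cot_val x) ((\eps v : K) *: u) =
  \sum_i \lsum_(w, c <- cot_rco x) ((eta i w : K) *: alpha i c).
Proof.
pose h (z : C \ox C) : C := \lsum_(u, v <- z) ((\eps v : K) *: u).
have lh : linear h by rewrite /h; lin.
rewrite -/(h _) (quasibases_eq qb x) (linear_big_sum _ _ lh); apply: eq_bigr => i _.
rewrite -[X in h X]/(\lsum_(w, c <- cot_rco x)
  ((eta i w : K) *: tmap (alpha i) id (\Delta c))).
rewrite (linear_lsum _ _ lh); apply: eq_lsum => w c.
rewrite (linear_eqs lh).2; congr (_ *: _).
by rewrite /h lsum_tmap; lin; apply: lsum_counitr.
Qed.

(** The dual basis of E: [quasi_val] at the element a(c1) (x) c2. *)
Lemma quasi_expand a : a = \sum_i bact s t (rcoord i a) (alpha i) 1.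
Proof.
apply: bicEndP => c.
have -> : (\sum_i bact s t (rcoord i a) (alpha i) 1) c =
    \sum_i alpha i (t (rcoord i a) c).
  rewrite (additive_big_sum (f := fun b : bicEnd g => b c)) //; apply: eq_bigr => i _.
  by rewrite bactE source1.
have := quasi_val (cot_comul a c); rewrite lsum_cot_comul; [|lin..].
rewrite lsum_counitr // => ->; apply: eq_bigr => i _.
rewrite cot_rco_comul // lsum_tmap; lin.
rewrite targetE /target_fun (linear_lsum (f := alpha i)) //.
by apply: eq_lsum => u v; rewrite rcoordE (linear_eqs (lbic _)).2.
Qed.

Lemma cot_comulD a b c : cot_comul (a + b) c = cot_comul a c + cot_comul b c.
Proof.
apply: val_inj; rewrite /= -[RHS]tsumDf; apply: eq_lsum => u v.
exact: ((linear_eqs (tpureK_linl v)).1 (a u) (b u)).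
Qed.

Lemma cot_comul_target a r c : cot_comul (a * t r) c = cot_comul a (t r c).
Proof.
apply: val_inj; rewrite /= [RHS]tmapE lsum_target; lin; by [].
Qed.

Lemma rcoordD i a b : rcoord i (a + b) = rcoord i a + rcoord i b.
Proof.
apply: dualCentP => c; rewrite -[RHS]/(rcoord i a c + rcoord i b c) !rcoordE cot_comulD.
exact: linearD.
Qed.

Lemma rcoord_target i a r : rcoord i (a * t r) = r * rcoord i a.
Proof.
apply: dualCentP => c; rewrite rcoordE cot_comul_target targetE /target_fun.
rewrite (linear_lsum (f := fun z => eta i (cot_comul a z))); lin.
apply: eq_lsum => u v; rewrite (linear_eqs (ldc _)).2 linearZ.
congr (_ * _); apply: esym; apply: rcoordE.
Qed.

(** E (x)_R E is generated, over the first factor, by the [alpha i] in the second: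
    these are the coordinates. They are well defined since the coordinates in R
    are left R-linear. *)
Definition lcoord i (X : EE) : bicEnd g := \tsum_(x, y <- X) (x * s (rcoord i y)).

Lemma lcoord_balanced i : balanced (fun e r => e * s r) (fun r e => e * t r)
  (fun x y => x * s (rcoord i y)).
Proof.
split=> [x x' y|x y y'|x r y]; first exact: mulrDl.
  by rewrite rcoordD sourceD mulrDr.
by rewrite rcoord_target sourceM mulrA.
Qed.

Lemma lcoordD i : {morph lcoord i : X Y / X + Y}.
Proof. by move=> X Y; apply: tsumD (lcoord_balanced i) X Y. Qed.

Lemma lcoord_pure i x y : lcoord i (x \oR y) = x * s (rcoord i y).
Proof. exact: tsum_pure (lcoord_balanced i) x y. Qed.

Lemma tpureR_sum x n (y : 'I_n -> bicEnd g) : x \oR (\sum_i y i) = \sum_i x \oR y i.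
Proof. by apply: (additive_big_sum (f := tpureR s t x)) => y1 y2; apply: tpureDr. Qed.

Lemma lcoord_expand X : X = \sum_i (lcoord i X \oR alpha i).
Proof.
move: X; apply: eq_tensor => [//|X Y|x y].
  rewrite -big_split; apply: eq_bigr => i _; rewrite lcoordD; exact: tpureDl.
rewrite -[tpure _ _ x y]/(x \oR y) {1}[y]quasi_expand tpureR_sum.
apply: eq_bigr => i _; rewrite lcoord_pure /bact source1 mulr1.
by apply: esym; apply: tpure_bal.
Qed.

Definition diag_eval (X : EE) c : C \ox C :=
  tsum (fun x y : bicEnd g => tmap x y (\Delta c)) X.
(** The refinement x(c1) (x) (y(c2) (x) c3) of [diag_eval], with the last two
    tensorands viewed in the cotensor product, where the eta_i are defined. *)
Definition diag_cot (X : EE) c : C \ox cot g :=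
  tsum (fun x y : bicEnd g => tmap x (cot_comul y) (\Delta c)) X.

Lemma diag_eval_balanced c : balanced (fun e r => e * s r) (fun r e => e * t r)
  (fun x y : bicEnd g => tmap x y (\Delta c)).
Proof.
split=> [x x' y|x y y'|x r y].
- rewrite -[RHS]tsumDf; apply: eq_lsum => u v.
  exact: ((linear_eqs (tpureK_linl (y v))).1 (x u) (x' u)).
- rewrite -[RHS]tsumDf; apply: eq_lsum => u v.
  exact: ((linear_eqs (tpureK_linr (x u))).1 (y v) (y' v)).
rewrite !tmapE.
transitivity (\lsum_(u, v <- \Delta c) (x (source_fun r u) \ot y v)).
  by apply: eq_lsum => u v; rewrite -sourceE.
rewrite (lsum_source_target _ _ (B := fun u v => x u \ot y v)); lin.
by apply: eq_lsum => u v; rewrite -targetE.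
Qed.

Lemma diag_evalD c : {morph diag_eval^~ c : X Y / X + Y}.
Proof. by move=> X Y; apply: tsumD (diag_eval_balanced c) X Y. Qed.

Lemma diag_eval_pure x y c : diag_eval (x \oR y) c = tmap x y (\Delta c).
Proof. exact: tsum_pure (diag_eval_balanced c) x y. Qed.

Lemma diag_eval_linear X : linear (diag_eval X).
Proof. by rewrite /diag_eval; apply: linear_big => p; lin. Qed.

(** [diag_cot] carries no more information than [diag_eval]. *)
Lemma diag_cotE X c :
  tmap id (@cot_val K C D g) (diag_cot X c) = tassoc (tmap (diag_eval X) id (\Delta c)).
Proof.
rewrite /diag_cot (additive_tsum _ _ (f := tmap id (@cot_val K C D g))); last first.
  by move=> z z'; rewrite (linear_eqs (tmap_linear _ lv)).1.
have lP := diag_eval_linear X.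
rewrite tmapE (linear_lsum (f := @tassoc K C C C)); lin.
transitivity (\sum_(p <- repr X) \lsum_(u, w <- \Delta c)
    tassoc (tmap p.1 p.2 (\Delta u) \ot w)).
  apply: eq_bigr => p _; rewrite tmap_comp //.
  transitivity (\lsum_(u, z <- \Delta c) \lsum_(v, w <- \Delta z)
      (p.1 u \ot (p.2 v \ot w))).
    apply: eq_lsum => u z /=; rewrite tmapE.
    by rewrite (linear_lsum (f := fun y => p.1 u \ot y)); lin.
  rewrite -lsum_comulA; lin; apply: eq_lsum => u w.
  rewrite tmapE (linear_lsum (f := fun y => tassoc (y \ot w))); lin.
  by apply: eq_lsum => v z; rewrite tassoc_pure.
rewrite [LHS]exchange_big; apply: eq_bigr => q _ /=.
rewrite -(additive_big_sum (f := fun y => tassoc (y \ot q.2))) // => y y'.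
by rewrite (linear_eqs (tpureK_linl _)).1 (linear_eqs (@tassoc_linear _ _ _ _)).1.
Qed.

(** The coordinates of X depend only on [diag_cot X]. *)
Lemma lcoordE i X c : lcoord i X c = \lsum_(u, w <- diag_cot X c) ((eta i w : K) *: u).
Proof.
have lh : linear (lsum (fun (u : C) (w : cot g) => (eta i w : K) *: u)) by lin.
rewrite /lcoord /diag_cot (additive_tsum _ _ (f := fun b : bicEnd g => b c)) //.
rewrite (additive_tsum _ _ (f := lsum (fun (u : C) (w : cot g) => (eta i w : K) *: u)));
  last first.
  by move=> z z'; rewrite (linear_eqs lh).1.
apply: eq_tsum => x y; rewrite lsum_tmap; lin.
rewrite -[LHS]/(x (s (rcoord i y) c)) sourceE /source_fun (linear_lsum (f := x)) //.
by apply: eq_lsum => u v; rewrite rcoordE (linear_eqs (lbic x)).2.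
Qed.

Lemma diag_eval_inj X Y : diag_eval X =1 diag_eval Y -> X = Y.
Proof.
move=> e; rewrite [X]lcoord_expand [Y]lcoord_expand; apply: eq_bigr => i _.
congr (_ \oR _); apply: bicEndP => c; rewrite !lcoordE; congr lsum.
by apply: (cot_injl fC); rewrite !diag_cotE; congr (tassoc (tmap _ _ _)); apply: funext.
Qed.

Definition bic_Delta a : EE := \sum_i (Delta_coord i a \oR alpha i).

(** The sum over i of the [alpha i] undoes the eta_i by [quasi_val], once the two
    coactions on a(c1) (x) c2 have been exchanged. *)
Lemma diag_eval_Delta a c : diag_eval (bic_Delta a) c = \Delta (a c).
Proof.
rewrite /bic_Delta (additive_big_sum (f := diag_eval^~ c)); last exact: diag_evalD.
transitivity (\sum_i \lsum_(y, u <- cot_rco (cot_comul a c))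
    (contract (eta i) y \ot alpha i u)).
  apply: eq_bigr => i _; rewrite diag_eval_pure cot_rco_comul // lsum_tmap; lin.
  by apply: eq_lsum => u v; rewrite Delta_coordE.
transitivity (\sum_i \lsum_(u, y <- cot_lco (cot_comul a c)) \lsum_(w, v <- cot_rco y)
    (u \ot ((eta i w : K) *: alpha i v))).
  apply: eq_bigr => i _.
  rewrite -(lsum_cot_lrcoA fC _
    (F := fun u w v => u \ot ((eta i w : K) *: alpha i v))); lin.
  apply: eq_lsum => y u; rewrite /contract.
  rewrite (linear_lsum (f := fun z => z \ot alpha i u)); lin.
  apply: eq_lsum => v w.
  by rewrite (linear_eqs (tpureK_linl _)).2 (linear_eqs (tpureK_linr _)).2.
transitivity (\lsum_(u, y <- cot_lco (cot_comul a c))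
    (u \ot (\lsum_(v, w <- cot_val y) ((\eps w : K) *: v)))).
  rewrite [LHS]exchange_big; apply: eq_bigr => q _.
  rewrite quasi_val (linear_big_sum _ _ (f := fun z => q.1 \ot z)); lin.
  by apply: eq_bigr => i _; rewrite (linear_lsum (f := fun z => q.1 \ot z)); lin.
rewrite (lsum_cot_lco fC _
  (B := fun u y => u \ot (\lsum_(v, w <- y) ((\eps w : K) *: v)))); lin.
rewrite (lsum_cot_comul _ _ (B := fun u v => \lsum_(u1, u2 <- \Delta u) (u1 \ot
  (\lsum_(v, w <- u2 \ot v) ((\eps w : K) *: v))))); lin.
rewrite -(lsum_counitr (f := fun c => \Delta (a c))); lin.
apply: eq_lsum => u v; rewrite -[X in _ *: X]tmap_id tmapE lsumZ.
apply: eq_lsum => u1 u2; rewrite lsum_pure; lin.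
by rewrite (linear_eqs (tpureK_linr _)).2.
Qed.

Lemma diag_cot_Delta a c : diag_cot (bic_Delta a) c = cot_lco (cot_comul a c).
Proof.
apply: (cot_injl fC); rewrite diag_cotE cot_lcoE //; congr tassoc.
by rewrite [RHS]tmap_comp //; [apply: eq_lsum => u v; rewrite diag_eval_Delta|lin].
Qed.

Lemma lcoord_Delta i a : lcoord i (bic_Delta a) = Delta_coord i a.
Proof. by apply: bicEndP => c; rewrite lcoordE diag_cot_Delta Delta_coordE. Qed.
End Coordinates.

(** * The bialgebroid axioms *)

Section Bialgebroid.
Context (K : comPzRingType) (C D : coalgType K) (g : {linear C -> D}).
Context (fC : flat C) (fD : flat D) (sD : dual_separates D).
Context (N : nat) (alpha : 'I_N -> bicEnd g) (eta : 'I_N -> klin (cot g) K^o).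
Context (qb : quasibases alpha eta).
Implicit Types (P : lmodType K) (a b e : bicEnd g) (c : C) (r : dualCent g).

Let lbic := @bicEnd_linear K C D g.
Let lct i := @contract_linear K C D g fC (eta i).

Local Notation s := (@source K C D g sD).
Local Notation t := (@target K C D g sD).
Local Notation EE := (tensR s t).
Local Notation EEE := (tensR3 s t).
Local Notation "x \oR y" := (tpureR s t x y) (at level 40).
Local Notation rcoord := (rcoord fC fD qb).
Local Notation lcoord := (lcoord fC fD qb).
Local Notation diag_eval := (@diag_eval K C D g sD).
Local Notation bic_Delta := (bic_Delta fC fD sD qb).
Implicit Types X Y : EE.

Lemma tpureR_bal x r y : (x * s r) \oR y = x \oR (y * t r).
Proof. exact: tpure_bal. Qed.

Lemma tpureRDl x x' y : (x + x') \oR y = x \oR y + x' \oR y.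
Proof. exact: tpureDl. Qed.

Lemma tpureRDr x y y' : x \oR (y + y') = x \oR y + x \oR y'.
Proof. exact: tpureDr. Qed.

Lemma bactR_balanced r r' : balanced (fun e r => e * s r) (fun r e => e * t r)
  (fun x y => bact s t r x 1 \oR bact s t 1 y r').
Proof.
rewrite /bact; split=> [x x' y|x y y'|x q y].
- by rewrite !mulrDl tpureRDl.
- by rewrite !mulrDl tpureRDr.
rewrite source1 target1 !mulr1 -!mulrA source_targetC -(source_targetC _ r').
by rewrite mulrA tpureR_bal !mulrA.
Qed.

Lemma bactR_pure r x y r' :
  bactR r (x \oR y) r' = (x * t r) \oR (y * s r').
Proof.
rewrite /bactR; refine (eq_trans (tsum_pure (bactR_balanced r r') x y) _).
by rewrite /bact source1 target1 !mulr1.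
Qed.

Lemma bactRD r r' : {morph (fun X : EE => bactR r X r') : X Y / X + Y}.
Proof. by move=> X Y; apply: tsumD (bactR_balanced r r') X Y. Qed.

Lemma diag_eval_bactR r X r' c : diag_eval (bactR r X r') c = diag_eval X (s r' (t r c)).
Proof.
move: X; apply: eq_tensor => [X Y|X Y|x y]; rewrite ?bactRD ?diag_evalD //.
rewrite -[tpure _ _ x y]/(x \oR y) bactR_pure !diag_eval_pure !tmapE.
rewrite (lsum_source _ _ _ (B := fun u v => x u \ot y v)); lin.
by rewrite (lsum_target _ _ _ (B := fun u v => x u \ot y (s r' v))); lin.
Qed.

Lemma lcoord_bactR i r X : lcoord i (bactR r X 1) = lcoord i X * t r.
Proof.
move: X; apply: eq_tensor => [X Y|X Y|x y]; rewrite ?bactRD ?lcoordD ?mulrDl //.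
rewrite -[tpure _ _ x y]/(x \oR y) bactR_pure source1 mulr1 !lcoord_pure.
by rewrite -!mulrA source_targetC.
Qed.

(** Insertion of [alpha i] as last factor and the matching coordinate: as in
    E (x)_R E, they reduce an equality of threefold tensors to E (x)_R E. *)
Definition insert3 i (X : EE) : EEE := \tsum_(x, y <- X) tpureR3 x (y \oR alpha i).
Definition coord3 i (Z : EEE) : EE := \tsum_(x, Y <- Z) (x \oR lcoord i Y).

Lemma tpureR3Dl x x' Y : tpureR3 (x + x') Y = tpureR3 x Y + tpureR3 x' Y :> EEE.
Proof. exact: tpureDl. Qed.
Lemma tpureR3Dr x Y Y' : tpureR3 x (Y + Y') = tpureR3 x Y + tpureR3 x Y' :> EEE.
Proof. exact: tpureDr. Qed.
Lemma tpureR3_bal x r (Y : EE) : tpureR3 (x * s r) Y = tpureR3 x (bactR r Y 1) :> EEE.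
Proof. exact: tpure_bal. Qed.

Lemma insert3_balanced z : balanced (fun e r => e * s r) (fun r e => e * t r)
  (fun x y => tpureR3 x (y \oR z) : EEE).
Proof.
split=> [x x' y|x y y'|x r y]; rewrite ?tpureR3Dl ?tpureRDl ?tpureR3Dr //.
by rewrite tpureR3_bal bactR_pure source1 mulr1.
Qed.

Lemma insert3D i : {morph insert3 i : X Y / X + Y}.
Proof. by move=> X Y; apply: tsumD (insert3_balanced _) X Y. Qed.

Lemma insert3_pure i x y : insert3 i (x \oR y) = tpureR3 x (y \oR alpha i).
Proof. exact: tsum_pure (insert3_balanced _) x y. Qed.

Lemma coord3_balanced i : balanced (fun e r => e * s r) (fun r (X : EE) => bactR r X 1)
  (fun x Y => x \oR lcoord i Y).
Proof.
split=> [x x' Y|x Y Y'|x r Y]; rewrite ?tpureRDl ?lcoordD ?tpureRDr //.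
by rewrite lcoord_bactR tpureR_bal.
Qed.

Lemma coord3D i : {morph coord3 i : X Y / X + Y}.
Proof. by move=> X Y; apply: tsumD (coord3_balanced i) X Y. Qed.

Lemma coord3_pure i x Y : coord3 i (tpureR3 x Y) = x \oR lcoord i Y.
Proof. exact: tsum_pure (coord3_balanced i) x Y. Qed.

Lemma insert3_coord3 Z : Z = \sum_i insert3 i (coord3 i Z).
Proof.
move: Z; apply: eq_tensor => [//|X Y|x Y].
  by rewrite -big_split; apply: eq_bigr => i _; rewrite coord3D insert3D.
rewrite -[tpure _ _ x Y]/(tpureR3 x Y : EEE) {1}[Y](lcoord_expand fC fD qb).
rewrite (additive_big_sum (f := fun Y => tpureR3 x Y : EEE)); last exact: tpureR3Dr.
by apply: eq_bigr => i _; rewrite coord3_pure insert3_pure.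
Qed.

Lemma coord3_inj (Z Z' : EEE) : (forall i, coord3 i Z = coord3 i Z') -> Z = Z'.
Proof.
move=> e; rewrite [Z]insert3_coord3 [Z']insert3_coord3.
by apply: eq_bigr => i _; rewrite e.
Qed.

(** What makes the canonical reassociation additive. *)
Lemma tassocR_balanced : balanced (fun (X : EE) r => bactR 1 X r) (fun r e => e * t r)
  (fun X z => \tsum_(x, y <- X) (tpureR3 x (y \oR z) : EEE)).
Proof.
split=> [X Y z|X z z'|X r z].
- exact: tsumD (insert3_balanced z) X Y.
- by rewrite -[RHS]tsumDf; apply: eq_tsum => x y; rewrite tpureRDr tpureR3Dr.
rewrite {1}/bactR (additive_tsum _ _
    (f := fun X : EE => \tsum_(x, y <- X) (tpureR3 x (y \oR z) : EEE)));
  last exact: tsumD (insert3_balanced z).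
apply: eq_tsum => x y; refine (eq_trans (tsum_pure (insert3_balanced z) _ _) _).
by rewrite /bact source1 target1 !mulr1 tpureR_bal.
Qed.

(** After taking the i-th coordinate and evaluating along the comultiplication, both
    sides become the comultiplication of the i-th coordinate of [bic_Delta e]:
    on the left since [diag_eval] of [bic_Delta] is known, on the right since
    [contract] is left colinear. *)
Lemma bic_Delta_coassoc e :
  tassocR (\tsum_(x, y <- bic_Delta e) tpureR3' (bic_Delta x) y)
  = \tsum_(x, y <- bic_Delta e) tpureR3 x (bic_Delta y).
Proof.
have tassocD : {morph (@tassocR K (dualCent g) (bicEnd g) s t) : X Y / X + Y}.
  by move=> X Y; apply: tsumD tassocR_balanced X Y.
apply: coord3_inj => i; apply: (diag_eval_inj fC fD qb) => c.
pose f Z : C \ox C := diag_eval (coord3 i Z) c.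
have fD' : {morph f : X Y / X + Y} by move=> X Y; rewrite /f coord3D diag_evalD.
rewrite -!/(f _) (additive_tsum _ _ tassocD) !(additive_tsum _ _ fD').
transitivity (\Delta (contract (eta i) (cot_comul e c))); last first.
  transitivity (tmap id (contract (eta i)) (diag_cot (bic_Delta e) c)).
    by rewrite diag_cot_Delta -[LHS](lsum_id _ (@linear_id K _)) (lsum_contract fC); lin.
  have cD : {morph tmap (@id C) (contract (eta i)) : X Y / X + Y}.
    by move=> X Y; rewrite (linear_eqs (tmap_linear _ (lct i))).1.
  refine (eq_trans (additive_tsum _ _ cD) _).
  apply: eq_tsum => x y; rewrite /f coord3_pure diag_eval_pure tmap_comp //.
  by apply: eq_lsum => u v; rewrite lcoord_Delta Delta_coordE.
rewrite -(Delta_coordE fC fD sD qb) -lcoord_Delta.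
transitivity (\tsum_(x, y <- bic_Delta e) (\Delta ((x * s (rcoord i y)) c))); first last.
  rewrite -(additive_tsum _ _ (f := fun b : bicEnd g => \Delta (b c))) //.
  by move=> X Y; apply: ((linear_eqs (@comul_linear _ _)).1 (X c) (Y c)).
apply: eq_tsum => x y; rewrite -[(x * _) c]/(x (s (rcoord i y) c)).
rewrite -(diag_eval_Delta fC fD sD qb).
refine (eq_trans (congr1 f (tsum_pure tassocR_balanced (bic_Delta x) y)) _).
rewrite (additive_tsum _ _ fD') /diag_eval; apply: eq_tsum => x1 x2.
rewrite /f coord3_pure lcoord_pure diag_eval_pure !tmapE.
by rewrite (lsum_source _ _ _ (B := fun u v => x1 u \ot x2 v)); lin.
Qed.

Lemma bic_Delta_unique a X : (forall c, diag_eval X c = \Delta (a c)) -> bic_Delta a = X.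
Proof. by move=> e; apply: (diag_eval_inj fC fD qb) => c; rewrite diag_eval_Delta e. Qed.

Lemma bic_eps_bact r e r' : bic_eps (bact s t r e r') = r * bic_eps e * r'.
Proof.
apply: dualCentP => c; rewrite bic_epsE bactE -[RHS]/((r * bic_eps e * r') c).
have le : linear (fun c => \eps (e c) : K^o) by lin.
rewrite sourceE /source_fun (linear_lsum (f := fun c => \eps (e c))); lin.
rewrite (lsum_target _ _ _ (B := fun u v => \eps (e ((r' v : K) *: u)))); lin.
apply: eq_lsum => u v; rewrite (linear_eqs le).2 targetE /target_fun.
rewrite (linear_lsum (f := fun c => \eps (e c))); lin.
rewrite [RHS](@mulrC K); congr (_ * _); apply: eq_lsum => u' v'.
rewrite (linear_eqs le).2 -bic_epsE.
by [].
Qed.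

Lemma bic_Delta_counitl e : \tsum_(x, y <- bic_Delta e) bact s t (bic_eps x) y 1 = e.
Proof.
apply: bicEndP => c; rewrite (additive_tsum _ _ (f := fun b : bicEnd g => b c)) //.
pose h (z : C \ox C) : C := \lsum_(u, v <- z) ((\eps u : K) *: v).
have lh : linear h by rewrite /h; lin.
have hD : {morph h : X Y / X + Y} by move=> X Y; rewrite (linear_eqs lh).1.
have : h (diag_eval (bic_Delta e) c) = e c.
  by rewrite diag_eval_Delta; apply: lsum_counitl (@linear_id K _).
rewrite /diag_eval (additive_tsum _ _ hD) => he; refine (eq_trans _ he).
apply: eq_tsum => x y.
have -> : bact s t (bic_eps x) y 1 c = y (t (bic_eps x) c) by rewrite bactE source1.
rewrite targetE /target_fun (linear_lsum (f := y)) // /h lsum_tmap; lin.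
by apply: eq_lsum => u v; rewrite (linear_eqs (lbic y)).2 bic_epsE.
Qed.

Lemma bic_Delta_counitr e : \tsum_(x, y <- bic_Delta e) bact s t 1 x (bic_eps y) = e.
Proof.
apply: bicEndP => c; rewrite (additive_tsum _ _ (f := fun b : bicEnd g => b c)) //.
pose h (z : C \ox C) : C := \lsum_(u, v <- z) ((\eps v : K) *: u).
have lh : linear h by rewrite /h; lin.
have hD : {morph h : X Y / X + Y} by move=> X Y; rewrite (linear_eqs lh).1.
have : h (diag_eval (bic_Delta e) c) = e c.
  by rewrite diag_eval_Delta; apply: lsum_counitr (@linear_id K _).
rewrite /diag_eval (additive_tsum _ _ hD) => he; refine (eq_trans _ he).
apply: eq_tsum => x y.
have -> : bact s t 1 x (bic_eps y) c = x (s (bic_eps y) c) by rewrite bactE target1.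
rewrite sourceE /source_fun (linear_lsum (f := x)) // /h lsum_tmap; lin.
by apply: eq_lsum => u v; rewrite (linear_eqs (lbic x)).2 bic_epsE.
Qed.

(** [diag_eval] of both sides applies r to the middle of the threefold
    comultiplication of e(c). *)
Lemma bic_Delta_takeuchi e : takeuchi (bic_Delta e).
Proof.
move=> r; apply: (diag_eval_inj fC fD qb) => c.
have PD : {morph diag_eval^~ c : X Y / X + Y} by exact: diag_evalD.
rewrite !(additive_tsum _ _ PD).
pose h1 (z : C \ox C) : C \ox C := tmap (s r) id z.
pose h2 (z : C \ox C) : C \ox C := tmap id (t r) z.
have lh1 : linear h1 by rewrite /h1; lin.
have lh2 : linear h2 by rewrite /h2; lin.
have h1D : {morph h1 : X Y / X + Y} by move=> X Y; rewrite (linear_eqs lh1).1.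
have h2D : {morph h2 : X Y / X + Y} by move=> X Y; rewrite (linear_eqs lh2).1.
transitivity (h1 (diag_eval (bic_Delta e) c)).
  rewrite /diag_eval (additive_tsum _ _ h1D); apply: eq_tsum => x y.
  by rewrite -/(diag_eval _ c) diag_eval_pure /h1 tmap_comp.
transitivity (h2 (diag_eval (bic_Delta e) c)).
  rewrite diag_eval_Delta /h1 /h2 !tmapE.
  transitivity (\lsum_(u, v <- \Delta (e c)) (source_fun r u \ot v)).
    by apply: eq_lsum => u v; rewrite sourceE.
  rewrite (lsum_source_target _ _ (B := fun u v => u \ot v)); lin.
  by apply: eq_lsum => u v; rewrite targetE.
rewrite {1}/diag_eval (additive_tsum _ _ h2D); apply: eq_tsum => x y.
by rewrite diag_eval_pure /h2 tmap_comp.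
Qed.

(** [diag_eval] of a product applies x (x) y to the comultiplication of e'(c), and
    [diag_eval_Delta] can then be used again at e'(c). *)
Lemma bic_Delta_mul e e' : bic_Delta (e * e') = takeuchi_mul (bic_Delta e) (bic_Delta e').
Proof.
apply: bic_Delta_unique => c.
have PD : {morph diag_eval^~ c : X Y / X + Y} by exact: diag_evalD.
rewrite /takeuchi_mul (additive_tsum _ _ PD) -[(e * e') c]/(e (e' c)).
rewrite -(diag_eval_Delta fC fD sD qb) {2}/diag_eval; apply: eq_tsum => x y.
rewrite (additive_tsum _ _ PD) -(diag_eval_Delta fC fD sD qb) /diag_eval.
have lh : linear (tmap x y) by lin.
have hD : {morph tmap x y : X Y / X + Y} by move=> X Y; rewrite (linear_eqs lh).1.
rewrite (additive_tsum _ _ hD); apply: eq_tsum => x' y'.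
by rewrite -/(diag_eval _ c) diag_eval_pure tmap_comp.
Qed.

Theorem bicEnd_bialgebroid : right_bialgebroid bic_Delta (@bic_eps K C D g).
Proof.
split.
- exact: sourceD.
- exact: sourceM.
- exact: source_scalar.
- exact: targetD.
- exact: targetM.
- exact: target_scalar.
- exact: source_targetC.
- move=> e e'; apply: bic_Delta_unique => c; rewrite diag_evalD !diag_eval_Delta.
  by rewrite -(linear_eqs (@comul_linear _ _)).1.
- move=> r e r'; apply: bic_Delta_unique => c.
  by rewrite diag_eval_bactR diag_eval_Delta bactE.
- move=> e e'; apply: dualCentP => c.
  rewrite -[RHS]/(bic_eps e c + bic_eps e' c) !bic_epsE.
  by rewrite -(linear_eqs (@counit_linear _ _)).1.
- exact: bic_eps_bact.
- exact: bic_Delta_coassoc.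
- exact: bic_Delta_counitl.
- exact: bic_Delta_counitr.
- by apply: bic_Delta_unique => c; rewrite diag_eval_pure tmap_id.
- by apply: dualCentP => c; rewrite bic_epsE.
- exact: bic_Delta_takeuchi.
- exact: bic_Delta_mul.
- move=> e e'; apply: dualCentP => c; rewrite !bic_epsE.
  rewrite -[(e * e') c]/(e (e' c)) -[(_ * e') c]/(s (bic_eps e) (e' c)).
  rewrite sourceE /source_fun.
  rewrite (linear_lsum (f := \eps)) -?(lsum_counitl (f := fun c => \eps (e c))); lin.
  apply: eq_lsum => u v; rewrite (linear_eqs (@counit_linear _ _)).2 bic_epsE.
  exact: (@mulrC K).
- move=> e e'; apply: dualCentP => c; rewrite !bic_epsE.
  rewrite -[(e * e') c]/(e (e' c)) -[(_ * e') c]/(t (bic_eps e) (e' c)).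
  rewrite targetE /target_fun.
  rewrite (linear_lsum (f := \eps)) -?(lsum_counitr (f := fun c => \eps (e c))); lin.
  apply: eq_lsum => u v; rewrite (linear_eqs (@counit_linear _ _)).2 bic_epsE.
  exact: (@mulrC K).
Qed.

Lemma bicEnd_fin_gen : fin_gen (fun r a => bact s t r a 1).
Proof. by exists N, alpha => a; exists (fun i => rcoord i a); apply: quasi_expand. Qed.

(** The dual basis gives the lift: it is prescribed on the [alpha i]. *)
Lemma bicEnd_projective : projective (fun r a => bact s t r a 1).
Proof.
move=> P Q f h fsurj [hD hZ].
pose p i := projT1 (cid (fsurj (h (alpha i)))).
have pE i : f (p i) = h (alpha i) by rewrite /p; case: cid.
exists (fun a => \sum_i rcoord i a *: p i).
  split=> [a b|r a].
    by rewrite -big_split; apply: eq_bigr => i _; rewrite rcoordD scalerDl.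
  rewrite scaler_sumr; apply: eq_bigr => i _.
  by rewrite /bact source1 mulr1 rcoord_target scalerA.
move=> a; rewrite linear_sum [in RHS](quasi_expand fC fD sD qb a).
rewrite (additive_big_sum _ _ hD).
by apply: eq_bigr => i _; rewrite hZ linearZ pE.
Qed.
End Bialgebroid.

(** * Existence of quasibases *)

Section Existence.
Context (K : comPzRingType) (C D : coalgType K) (g : {linear C -> D}).
Implicit Types (c : C) (x : cot g).

Lemma tmap0l (U U' V V' : lmodType K) (h : V -> V') (z : U \ox V) :
  tmap (fun=> 0 : U') h z = 0.
Proof.
rewrite tmapE; apply: big1 => p _; exact: (linear0_fun (tpureK_linl _)).
Qed.

Lemma tmap0r (U U' V V' : lmodType K) (f : U -> U') (z : U \ox V) :
  tmap f (fun=> 0 : V') z = 0.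
Proof.
rewrite tmapE; apply: big1 => p _; exact: (linear0_fun (tpureK_linr _)).
Qed.

(** The components of the isomorphism and of its inverse. Left colinearity is
    over D only, hence its composition with g. *)
Lemma codepth_two_retract : left_codepth_two g ->
  exists N (pi : 'I_N -> C -> cot g) (sigma : 'I_N -> cot g -> C),
  [/\ (forall i, linear (pi i)) /\ (forall i, linear (sigma i)),
      (forall i c, tmap g id (cot_lco (pi i c)) = tmap g (pi i) (\Delta c)) /\
      (forall i c, cot_rco (pi i c) = tmap (pi i) id (\Delta c)),
      (forall i x, tmap g id (\Delta (sigma i x)) = tmap g (sigma i) (cot_lco x)) /\
      (forall i x, \Delta (sigma i x) = tmap (sigma i) id (cot_rco x)) &
      forall x, x = \sum_i pi i (sigma i x)].
Proof.
case=> N _ [M Mbic [f [lf fl fr] [h fK hK]]].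
pose inj i (c : C) : {ffun 'I_N -> C} := [ffun j => if j == i then c else 0].
have lr0 : rcoact (0 : M) = 0 := linear0_fun (rcoact_linear Mbic).
have ll0 : lcoact (0 : M) = 0 := linear0_fun (lcoact_linear Mbic).
have {}fl (p : cot g * M) : \sum_j tmap id (inj j) (tmap g id (\Delta (f p j))) =
    tmap id f (tmap id (fun x : cot g => (x, 0 : M)) (tmap g id (cot_lco p.1))
             + tmap id (fun y : M => (0 : cot g, y)) (lcoact p.2)).
  exact: (fl p).
have {}fr (p : cot g * M) : \sum_j tmap (inj j) id (\Delta (f p j)) =
    tmap f id (tmap (fun x : cot g => (x, 0 : M)) id (cot_rco p.1)
             + tmap (fun y : M => (0 : cot g, y)) id (rcoact p.2)).
  exact: (fr p).
have {}lf : linear (f : cot g * M -> {ffun 'I_N -> C}) by exact: lf.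
have lh : linear (h : {ffun 'I_N -> C} -> cot g * M).
  by move=> a u v; rewrite -{1}[u]hK -{1}[v]hK -lf fK.
pose i1 (x : cot g) : cot g * M := (x, 0).
pose i2 (y : M) : cot g * M := (0, y).
have li1 : linear i1.
  move=> a x y; have e : a *: 0 + 0 = 0 :> M by rewrite scaler0 addr0.
  exact: (esym (congr1 (pair (a *: x + y)) e)).
have li2 : linear i2.
  move=> a x y; have e : a *: 0 + 0 = 0 :> cot g by rewrite scaler0 addr0.
  exact: (esym (congr1 (pair^~ (a *: x + y)) e)).
have linj i : linear (inj i).
  move=> a x y; apply/ffunP => j; rewrite !ffunE.
  by case: (j == i); rewrite ?scaler0 ?addr0.
pose ev i (v : {ffun 'I_N -> C}) : C := v i.
have lev i : linear (ev i) by move=> a u v; rewrite /ev !ffunE.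
have p1 : linear (fst : cot g * M -> cot g) by [].
have lp : linear (fst \o h) by exact: linear_comp p1 lh.
have lpi i : linear ((fst \o h) \o inj i) by exact: linear_comp lp (linj i).
have evinj i j : ev i \o inj j = if j == i then id else fun=> 0.
  by apply: funext => c; rewrite /ev /= ffunE eq_sym; case: (j == i).
have suml (v : {ffun 'I_N -> C}) i :
    tmap id (ev i) (\sum_j tmap id (inj j) (tmap g id (\Delta (v j)))) =
    tmap g id (\Delta (v i)).
  rewrite (linear_big_sum _ _ (tmap_linear (@linear_id _ _) (lev i))).
  rewrite (bigD1 i) //= big1 => [|j ji].
    by rewrite addr0 tmap_comp // evinj eqxx tmap_id.
  by rewrite tmap_comp // evinj (negPf ji) tmap0r.
have sumr (v : {ffun 'I_N -> C}) i :
    tmap (ev i) id (\sum_j tmap (inj j) id (\Delta (v j))) = \Delta (v i).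
  rewrite (linear_big_sum _ _ (tmap_linear (lev i) (@linear_id _ _))).
  rewrite (bigD1 i) //= big1 => [|j ji].
    by rewrite addr0 tmap_comp // evinj eqxx tmap_id.
  by rewrite tmap_comp // evinj (negPf ji) tmap0l.
have suml' i c : \sum_j tmap id (inj j) (tmap g id (\Delta (inj i c j))) =
    tmap id (inj i) (tmap g id (\Delta c)).
  rewrite (bigD1 i) //= big1 => [|j ji]; first by rewrite addr0 ffunE eqxx.
  rewrite ffunE (negPf ji).
  by rewrite (linear0_fun (@comul_linear _ _)) !(linear0_fun (tmap_linear _ _)) //; lin.
have sumr' i c : \sum_j tmap (inj j) id (\Delta (inj i c j)) = tmap (inj i) id (\Delta c).
  rewrite (bigD1 i) //= big1 => [|j ji]; first by rewrite addr0 ffunE eqxx.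
  rewrite ffunE (negPf ji).
  by rewrite (linear0_fun (@comul_linear _ _)) !(linear0_fun (tmap_linear _ _)) //; lin.
exists N, (fun i c => (h (inj i c)).1), (fun i x => f (i1 x) i); split.
- split=> i; first by apply: (linear_comp p1); apply: (linear_comp lh).
  by apply: (linear_comp (lev i)); apply: (linear_comp lf).
- split=> i c.
    have := congr1 (tmap id (fst \o h)) (fl (h (inj i c))); rewrite hK suml'.
    rewrite [LHS]tmap_comp //.
    rewrite [LHS]tmap_comp // [RHS]tmap_comp //.
    have -> : (fst \o h) \o f = fst by apply: funext => p /=; rewrite fK.
    rewrite (linear_eqs (tmap_linear _ p1)).1 // => ->.
    rewrite [tmap id fst (tmap id i1 _)]tmap_comp //.
    rewrite [tmap id fst (tmap id i2 _)]tmap_comp //.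
    by rewrite tmap0r addr0 tmap_comp.
  have := congr1 (tmap (fst \o h) id) (fr (h (inj i c))); rewrite hK sumr'.
  rewrite [LHS]tmap_comp //.
  rewrite [RHS]tmap_comp //.
  have -> : (fst \o h) \o f = fst by apply: funext => p /=; rewrite fK.
  rewrite (linear_eqs (tmap_linear p1 _)).1 // => ->.
  rewrite [tmap fst id (tmap i1 id _)]tmap_comp //.
  rewrite [tmap fst id (tmap i2 id _)]tmap_comp //.
  by rewrite tmap0l addr0 tmap_id.
- split=> i x.
    have := congr1 (tmap id (ev i)) (fl (i1 x)); rewrite suml /= ll0 => ->.
    rewrite [X in _ + X](linear0_fun (tmap_linear _ li2)) // addr0.
    by rewrite -/i1 [tmap id i1 _]tmap_comp // [tmap id f _]tmap_comp // [LHS]tmap_comp.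
  have := congr1 (tmap (ev i) id) (fr (i1 x)); rewrite sumr /= lr0 => ->.
  rewrite [X in _ + X](linear0_fun (tmap_linear li2 _)) // addr0.
  by rewrite -/i1 [tmap f id _]tmap_comp // [LHS]tmap_comp.
move=> x; transitivity (h (f (i1 x))).1; first by rewrite fK.
rewrite -(linear_big_sum _ _ (linear_comp p1 lh)); congr (h _).1.
apply/ffunP => j; rewrite sum_ffunE (bigD1 j) //= big1 => [|i ij];
  rewrite ffunE ?eqxx ?addr0 //.
by rewrite eq_sym (negPf ij).
Qed.

(** Right colinearity determines sigma_i by the counit composed with it, and pi_i by
    pi_i followed by the counit on the second tensorand; left D-colinearity makes
    the former central and the latter an element of E. Substituting both in
    x = sum_i pi_i(sigma_i(x)) gives the quasibase equation. *)
Lemma quasibases_exist : flat C -> left_codepth_two g ->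
  exists N (alpha : 'I_N -> bicEnd g) (eta : 'I_N -> klin (cot g) K^o),
  quasibases alpha eta.
Proof.
move=> fC /codepth_two_retract [N [pi [sigma [[lpi lsg] [pil pir] [sgl sgr] pisg]]]].
have llc := @cot_lco_linear K C D g fC; have lrc := @cot_rco_linear K C D g fC.
have lv := @cot_val_linear K C D g.
pose te (z : C \ox C) : C := \lsum_(u, v <- z) ((\eps v : K) *: u).
have lte : linear te by rewrite /te; lin.
pose al i c := te (cot_val (pi i c)).
have lal i : linear (al i) by apply: (linear_comp lte); lin.
have piE i c : tmap (al i) id (\Delta c) = cot_val (pi i c).
  transitivity (\lsum_(w, v <- cot_rco (pi i c)) (te (cot_val w) \ot v)).
    by rewrite pir lsum_tmap; lin.
  rewrite (lsum_cot_rco fC _ (B := fun z v => te z \ot v)); lin.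
  rewrite -[RHS](lsum_id _ (@linear_id K _)); apply: eq_lsum => u v.
  rewrite -(lsum_counitl v (f := fun v => u \ot v)); lin; apply: eq_lsum => v1 v2.
  by rewrite /te lsum_pure; lin; rewrite (linear_eqs (tpureK_linl _)).2.
have Dal i c (P : lmodType K) (B : C -> C -> P) :
    (forall v, linear (B^~ v)) -> (forall u, linear (B u)) ->
    \lsum_(u, v <- \Delta (al i c)) B u v =
    \lsum_(u, v <- cot_val (pi i c)) \lsum_(u1, u2 <- \Delta u) ((\eps v : K) *: B u1 u2).
  move=> Bl Br; rewrite /al /te (linear_lsum (f := fun z => lsum B (\Delta z))); lin.
  apply: eq_lsum => u v; rewrite -lsumZ (linear_eqs (@comul_linear _ _)).2.
  exact: (linear_eqs (tsumK_linear Bl Br)).2.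
have al_bic i : {a : bicEnd g | forall c, a c = al i c}.
  apply: exists_bicEnd => [//|c|c].
    rewrite Dal; lin.
    transitivity (\lsum_(d, w <- tmap g (pi i) (\Delta c)) (d \ot te (cot_val w)));
      last by rewrite lsum_tmap; lin.
    rewrite -pil lsum_tmap; lin.
    rewrite (lsum_cot_lco fC _ (B := fun u z => g u \ot te z)); lin.
    apply: eq_lsum => u v; apply: eq_lsum => u1 u2.
    by rewrite /te lsum_pure; lin; rewrite (linear_eqs (tpureK_linr _)).2.
  rewrite Dal; lin.
  rewrite (lsum_cot _ (F := fun u d v => (\eps v : K) *: (u \ot d))); lin.
  transitivity (\lsum_(u, v <- cot_val (pi i c)) (u \ot g v)).
    apply: eq_lsum => u v; rewrite -(lsum_counitr v (f := fun v => u \ot g v)); lin.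
    by [].
  by rewrite -piE lsum_tmap; lin.
pose alpha i := sval (al_bic i).
have alphaE i c : alpha i c = al i c by rewrite /alpha; case: (al_bic i).
have leta i : linear (fun x => \eps (sigma i x) : K^o) by lin.
exists N, alpha, (fun i => mkklin (leta i)); split=> [i d x|x].
  transitivity (d (g (sigma i x))).
    rewrite -(lsum_counitr (f := fun c => d (g c))); lin.
    have := congr1 (lsum (fun u v => (d u : K) *: \eps v)) (sgl i x).
    rewrite !lsum_tmap; [|lin..] => e.
    refine (eq_trans (esym e) _); apply: eq_lsum => u v; exact: (@mulrC K).
  rewrite -(lsum_counitl (f := fun c => d (g c))); lin.
  by rewrite sgr lsum_tmap; lin.
rewrite {1}(pisg x) (linear_big_sum _ _ lv); apply: eq_bigr => i _.
rewrite -piE; have -> : tmap (al i) id = tmap (alpha i) (@id C).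
  by congr (tmap _ _); apply: funext => c; rewrite alphaE.
have la := @bicEnd_linear K C D g (alpha i).
rewrite -(lsum_counitl (f := fun c => tmap (alpha i) id (\Delta c))); lin.
by rewrite sgr lsum_tmap; lin.
Qed.
End Existence.

Theorem theorem6p9 (K : comPzRingType) (C D : coalgType K)
    (hK : base_assumption C D)
    (g : {linear C -> D}) (hg : coalgebra_hom g) (hcd : left_codepth_two g) :
  exists (s t : dualCent g -> bicEnd g) (Delta_E : bicEnd g -> tensR s t)
         (eps_E : bicEnd g -> dualCent g),
    [/\ right_bialgebroid Delta_E eps_E,
        fin_gen (fun r a => bact s t r a 1)
        /\ projective (fun r a => bact s t r a 1),
        [/\ forall r c, s r c = \tsum_(c1, c2 <- \Delta c) ((r c2 : K) *: c1),
            forall r c, t r c = \tsum_(c1, c2 <- \Delta c) ((r c1 : K) *: c2),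
            forall r a r' c,
              bact s t r a r' c =
              \tsum_(c1, x <- \Delta c) \tsum_(c2, c3 <- \Delta x)
                ((r c1 * r' c3 : K) *: a c2) &
            forall a c, eps_E a c = \eps (a c)],
        exists N (alpha : 'I_N -> bicEnd g) (eta : 'I_N -> klin (cot g) K^o),
          quasibases alpha eta &
        forall N (alpha : 'I_N -> bicEnd g) (eta : 'I_N -> klin (cot g) K^o),
          quasibases alpha eta ->
          forall a : bicEnd g, exists2 beta : 'I_N -> bicEnd g,
            forall i c,
              beta i c =
              \tsum_(c', w <- cot_lift_r g
                                (tassoc (tmap (\Delta \o a) id (\Delta c))))
                ((eta i w : K) *: c') &
            Delta_E a = \sum_i tpureR s t (beta i) (alpha i)].
Proof.
have [fC fD sD] : [/\ flat C, flat D & dual_separates D].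
  case: hK => [hF|[fC fD _ sD]]; last by [].
  by split; [exact: field_flat|exact: field_flat|exact: field_dual_separates].
have [N [alpha [eta qb]]] := quasibases_exist fC hcd.
exists (source sD), (target sD), (bic_Delta fC fD sD qb), (@bic_eps K C D g); split.
- exact: bicEnd_bialgebroid.
- split; [exact: bicEnd_fin_gen qb|exact: bicEnd_projective qb].
- split; [exact: sourceE|exact: targetE| |exact: bic_epsE] => r a r' c.
  have la := bicEnd_linear a; have lr := @dualCent_linear K C D g.
  rewrite bactE sourceE /source_fun (linear_lsum (f := a)) //.
  rewrite (lsum_target _ _ _ (B := fun u v => a ((r' v : K) *: u))); lin.
  transitivity (\lsum_(x, w <- \Delta c) \lsum_(u, v <- \Delta x)
      ((r u : K) *: ((r' w : K) *: a v))).
    apply: eq_lsum => x w; rewrite (linear_eqs la).2 targetE /target_fun.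
    rewrite (linear_lsum (f := a)) // lsumZ.
    by apply: eq_lsum => u v; rewrite (linear_eqs la).2 !scalerA mulrC.
  rewrite lsum_comulA; lin.
  by apply: eq_lsum => u x; apply: eq_lsum => v w; rewrite scalerA.
- by exists N, alpha, eta.
move=> N' alpha' eta' qb' a; exists (fun i => Delta_coord fC fD sD qb' i a) => [i c|].
  by rewrite Delta_coordE /contract /cot_lco /= tmap_comp //; apply: comul_linear.
by apply: bic_Delta_unique => c; apply: (diag_eval_Delta fC fD sD qb').
Qed.
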